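(* Let $\Phi$ be a commutative ring with unity $1\neq 0$, and let $\Delta$ be a basic set of derivation operators containing at least two elements. Then the ideal membership problem for differential polynomial algebras $\Phi\{x_1,\ldots,x_n\}$ (with respect to $\Delta$) is algorithmically undecidable: there is no algorithm which, for every finite sequence of differential polynomials $f,f_1,\ldots,f_k\in\Phi\{x_1,\ldots,x_n\}$, determines whether $f$ belongs to the differential ideal generated by $f_1,\ldots,f_k$.
   Context: $\Delta=\{\delta_1,\ldots,\delta_m\}$ is a set of symbols for commuting derivations. $\Phi$ is regarded as a differential ring on which all $\delta_i$ act as zero. The differential polynomial ring $\Phi\{x_1,\ldots,x_n\}$ is the polynomial ring over $\Phi$ in the algebraically independent variables $\theta(x_i)$, where $1\le i\le n$ and $\theta=\delta_1^{j_1}\cdots\delta_m^{j_m}$ ranges over the free commutative monoid generated by $\Delta$; each $\delta_l$ acts as the unique derivation with $\delta_l(\theta(x_i))=(\delta_l\theta)(x_i)$ and $\delta_l(\Phi)=0$. A differential ideal is an ideal closed under all $\delta_l$; the differential ideal generated by a set is the smallest such ideal containing it. *)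

(* Defs.v *)
From HB Require Import structures.
From mathcomp Require Import all_boot all_algebra.
From mathcomp Require Import finmap.
From mathcomp.multinomials Require Import monalg.

Set Implicit Arguments.
Unset Strict Implicit.
Unset Printing Implicit Defensive.

Import GRing.Theory.
Local Open Scope ring_scope.

Inductive recf : Type :=
| rZero
| rSucc
| rProj of nat
| rComp of recf & list recf
| rPrec of recf & recf
| rMu of recf.

Inductive reval : recf -> seq nat -> nat -> Prop :=
| re_zero v : reval rZero v 0
| re_succ v : reval rSucc v (nth 0%N v 0).+1
| re_proj i v : reval (rProj i) v (nth 0%N v i)
| re_comp f gs v ws y :
    revals gs v ws -> reval f ws y -> reval (rComp f gs) v y
| re_prec0 f g v y : reval f v y -> reval (rPrec f g) (0%N :: v) y
| re_precS f g k v r y :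
    reval (rPrec f g) (k :: v) r -> reval g (k :: r :: v) y ->
    reval (rPrec f g) (k.+1 :: v) y
| re_mu f v k :
    reval f (k :: v) 0 ->
    (forall j, (j < k)%N -> exists y, reval f (j :: v) y.+1) ->
    reval (rMu f) v k
with revals : list recf -> seq nat -> seq nat -> Prop :=
| res_nil v : revals nil v [::]
| res_cons g gs v w ws :
    reval g v w -> revals gs v ws -> revals (g :: gs) v (w :: ws).

Definition rec_decidable (T : countType) (P : T -> Prop) : Prop :=
  exists p : recf, forall u : T,
    (P u -> reval p [:: choice.pickle u] 1%N) /\
    (~ P u -> reval p [:: choice.pickle u] 0%N).

(* The indeterminate theta(x_i), theta = d_0^(j_0) ... d_(m-1)^(j_(m-1)),   *)
(* is coded by the pair (i, [ffun l => j_l]).                                *)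
Definition dgen (n m : nat) := ('I_n * {ffun 'I_m -> nat})%type.

(* Phi{x_1..x_n}: the polynomial ring over Phi in the algebraically          *)
(* independent indeterminates theta(x_i).                                    *)
Definition dpoly (Phi : comNzRingType) (n m : nat) :=
  {malg Phi[{cmonom dgen n m}]}.

Definition dvar (Phi : comNzRingType) (n m : nat) (g : dgen n m)
  : dpoly Phi n m := << ucm g >>.

Definition dshift (n m : nat) (l : 'I_m) (g : dgen n m) : dgen n m :=
  (g.1, [ffun j => (g.2 j + (j == l))%N]).

(* delta_l applied to a monomial (with coefficient 1), by Leibniz' rule     *)
Definition dmon (Phi : comNzRingType) (n m : nat) (l : 'I_m)
  (mo : cmonom (dgen n m)) : dpoly Phi n m :=
  \sum_(g <- finsupp mo)
     ((<< divcm mo (ucm g) >> * dvar Phi (dshift l g)) *+ mo g).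

(* The derivation delta_l on Phi{x_1..x_n}: the Phi-linear extension of     *)
(* dmon; it is the unique derivation with delta_l(Phi) = 0 and               *)
(* delta_l(theta(x_i)) = (delta_l theta)(x_i).                               *)
Definition delta (Phi : comNzRingType) (n m : nat) (l : 'I_m)
  (p : dpoly Phi n m) : dpoly Phi n m :=
  \sum_(mo <- msupp p) (p@_mo *: dmon Phi l mo).

Definition in_diff_ideal (Phi : comNzRingType) (n m : nat)
  (fs : seq (dpoly Phi n m)) (f : dpoly Phi n m) : Prop :=
  forall S : dpoly Phi n m -> Prop,
    S 0 ->
    (forall a b, S a -> S b -> S (a + b)) ->
    (forall r a, S a -> S (r * a)) ->
    (forall (l : 'I_m) a, S a -> S (delta l a)) ->
    (forall g, g \in fs -> S g) ->
    S f.

Definition dcode (n m : nat) :=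
  seq (int * seq (dgen n m * nat)).

Definition dinterp (Phi : comNzRingType) (n m : nat) (c : dcode n m)
  : dpoly Phi n m :=
  \sum_(t <- c) (t.1%:~R * \prod_(ge <- t.2) dvar Phi ge.1 ^+ ge.2).

Definition dinstance (m : nat) :=
  {n : nat & (dcode n m * seq (dcode n m))%type}.

Definition dmember (Phi : comNzRingType) (m : nat) (u : dinstance m) : Prop :=
  in_diff_ideal (map (dinterp Phi (m:=m)) (tagged u).2)
                (dinterp Phi (tagged u).1).

(* Main.v *)
Require Import Defs.
From HB Require Import structures.
From mathcomp Require Import all_boot all_algebra.
From mathcomp Require Import finmap.
From mathcomp.multinomials Require Import monalg.
From mathcomp Require Import ring zify.
From Stdlib Require Import FunctionalExtensionality ClassicalEpsilon.

Set Implicit Arguments.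
Unset Strict Implicit.
Unset Printing Implicit Defensive.

Import GRing.Theory.

(* A counter machine with program P is encoded with state variables Q_i that
   are constants (their derivatives are generators) and two variables A_c, Z_c
   for each counter c; the configuration (i, s) is the monomial
     Q_i * prod_c A_c^(s c) * Z_c,
   where A_c^(k) is the k-th derivative for one fixed derivation.  An increment is the relation Q_i A_c = Q_j A_c',
   whose derivatives give all Q_i A_c^(k) = Q_j A_c^(k+1) since the Q are
   constants.  A zero test is (Q_i - Q_j) A_c Z_c = 0: its derivatives are the
   (Q_i - Q_j) (A_c Z_c)^(k), total derivatives, and these are killed by
   "integration by parts", i.e. by the linear functional that replaces
   A_c^(a) Z_c^(z) by (-1)^z A_c^(a+z).  Composing this substitution with the
   indicator of the non-halting configurations gives a functional vanishing on
   all delta_l(p) and on all multiples of the generators, hence on the ideal.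
   So a configuration lies in the ideal iff the machine halts on it.

   Given a decision procedure p, take the machine that computes the code of a
   membership instance from three numbers, runs p on it, and halts iff the
   answer is 0; feeding it the data of its own instance is contradictory. *)

Local Open Scope ring_scope.

(** * Derivations on monomials *)

Section Weight.
Variable I : choiceType.
Implicit Types (h : I -> nat) (mo : cmonom I).

(** The extension of [h] to monomials that turns products into sums. Every quantity read off a
    monomial below (degrees, state, counters, exponent of the sign) is such a weight. *)
Definition weight h mo : nat := (\sum_(g <- finsupp mo) mo g * h g)%N.

Lemma weightEw h mo (E : {fset I}) : (finsupp mo `<=` E)%fset ->
  weight h mo = (\sum_(g <- E) mo g * h g)%N.
Proof.
move=> le; rewrite /weight (big_fset_incl _ le) // => i iE.
by rewrite -cmE_neq0 negbK => /eqP ->.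
Qed.

Lemma weightM h mo1 mo2 :
  weight h (mmul mo1 mo2) = (weight h mo1 + weight h mo2)%N.
Proof.
rewrite [weight h mo1](weightEw _ (fsubsetUl _ (finsupp mo2))).
rewrite [weight h mo2](weightEw _ (fsubsetUr (finsupp mo1) _)).
rewrite /weight mdomD -big_split /=.
by apply: eq_bigr => g _; rewrite cmM mulnDl.
Qed.

Lemma weightU h g : weight h (ucm g) = h g.
Proof. by rewrite /weight mdomU big_seq_fset1 cmUU mul1n. Qed.

Lemma weight1 h : weight h mone = 0%N.
Proof. by rewrite /weight mdom1 big_seq_fset0. Qed.

Lemma weight_eq0 h h' mo : (forall g, h' g = 0%N -> h g = 0%N) ->
  weight h' mo = 0%N -> weight h mo = 0%N.
Proof.
move=> hh' /eqP; rewrite /weight sum_nat_seq_eq0 => /allP h0.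
rewrite big_seq big1 // => g gmo; have /eqP := h0 g gmo.
have /negPf : mo g != 0%N by rewrite cmE_neq0.
by case: (mo g) => // k _ /eqP; rewrite muln_eq0 /= => /eqP /hh' ->; rewrite muln0.
Qed.

Lemma divcmK g mo : g \in finsupp mo -> mmul (divcm mo (ucm g)) (ucm g) = mo.
Proof.
rewrite -cmE_neq0 => mog; apply/eqP/cmP => i.
rewrite cmM divcmE cmU; case: eqP => [<-|_]; first by rewrite subnK // lt0n.
by rewrite subn0 addn0.
Qed.

Lemma divcm_mull g mo1 mo2 : g \in finsupp mo1 ->
  divcm (mmul mo1 mo2) (ucm g) = mmul (divcm mo1 (ucm g)) mo2.
Proof.
rewrite -cmE_neq0 => mog; apply/eqP/cmP => i.
rewrite divcmE !cmM divcmE cmU; case: eqP => [<-|_]; last by rewrite !subn0.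
by rewrite addnBAC // lt0n.
Qed.

Definition mon (gs : seq I) : cmonom I := foldr (fun g mo => mmul (ucm g) mo) mone gs.

Lemma weight_mon h gs : weight h (mon gs) = (\sum_(g <- gs) h g)%N.
Proof.
elim: gs => [|g gs IH] /=; first by rewrite big_nil weight1.
by rewrite big_cons weightM weightU IH.
Qed.

End Weight.
Arguments mon : simpl never.

Lemma sum_leibniz (R : nzRingType) (I : Type) (r : seq I) (F G : I -> R) x y :
  (\sum_(i <- r) F i) * y + x * (\sum_(i <- r) G i)
    = \sum_(i <- r) (F i * y + x * G i).
Proof. by rewrite mulr_suml mulr_sumr big_split. Qed.

(** One generator's share of the Leibniz rule for a product of monomials, where it has exponents [a]
    and [b]. The quotient [D] of the product factors through a monomial only if the generator occurs
    there; otherwise the multiplicity 0 removes the term. *)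
Lemma leibniz_term (R : comNzRingType) (D D1 D2 M1 M2 v : R) (a b : nat) :
  (a != 0%N -> D = D1 * M2) -> (b != 0%N -> D = M1 * D2) ->
  D * v *+ (a + b) = D1 * v *+ a * M2 + M1 * (D2 * v *+ b).
Proof.
move=> Ha Hb; rewrite mulrnDr; congr (_ + _).
  have [->|/Ha ->] := eqVneq a 0%N; first by rewrite !mulr0n mul0r.
  by rewrite mulrnAl mulrAC.
have [->|/Hb ->] := eqVneq b 0%N; first by rewrite !mulr0n mulr0.
by rewrite mulrnAr mulrA.
Qed.

(** Both sides are bilinear in [p] and [q], so the rule need only hold on a spanning family; the
    spanning property is given as an induction principle. *)
Lemma leibniz_span (R : comNzRingType) (A : comAlgType R) (T : Type)
    (e : T -> A) (d : A -> A) :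
    (forall P : A -> Prop, P 0 -> (forall p q, P p -> P q -> P (p + q)) ->
      (forall c t, P (c *: e t)) -> forall p, P p) ->
    d 0 = 0 -> {morph d : p q / p + q} ->
    (forall c t, d (c *: e t) = c *: d (e t)) ->
    (forall c t1 t2, d (c *: (e t1 * e t2)) = c *: d (e t1 * e t2)) ->
    (forall t1 t2, d (e t1 * e t2) = d (e t1) * e t2 + e t1 * d (e t2)) ->
  forall p q, d (p * q) = d p * q + p * d q.
Proof.
move=> ind d0 dD dZ dZM dM p q.
elim/ind: p => [|p1 p2 IH1 IH2|c t1]; first by rewrite !(mul0r, d0) addr0.
  by rewrite !(mulrDl, dD) IH1 IH2 addrACA.
elim/ind: q => [|q1 q2 IH1 IH2|c' t2]; first by rewrite !(mulr0, d0) addr0.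
  by rewrite !(mulrDr, dD) IH1 IH2 addrACA.
by rewrite !dZ -!scalerAl -!scalerAr !scalerA dZM dM scalerDr.

Qed.

Section Derivation.
Variables (Phi : comNzRingType) (n m : nat).
Implicit Types (p q : dpoly Phi n m) (l : 'I_m) (g : dgen n m).

Local Notation dm := (dmon Phi).

Lemma delta_mmap l p : delta l p = mmap (@malgC _ Phi) (dm l) p.
Proof. by rewrite /delta /mmap; apply: eq_bigr => mo _; rewrite mul_malgC. Qed.

Lemma delta0 l : delta l (0 : dpoly Phi n m) = 0.
Proof. by rewrite delta_mmap raddf0. Qed.

Lemma deltaD l : {morph (@delta Phi n m l) : p q / p + q}.
Proof. by move=> p q; rewrite !delta_mmap raddfD. Qed.

Lemma deltaU l c mo : delta l (<< c *g mo >> : dpoly Phi n m) = c *: dm l mo.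
Proof. by rewrite delta_mmap mmapU mul_malgC. Qed.

Lemma dmonEw l (mo : cmonom (dgen n m)) (E : {fset dgen n m}) :
  (finsupp mo `<=` E)%fset ->
  dm l mo = \sum_(g <- E)
     ((<< divcm mo (ucm g) >> * dvar Phi (dshift l g)) *+ mo g).
Proof.
move=> le; rewrite /dmon (big_fset_incl _ le) // => i iE.
by rewrite -cmE_neq0 negbK => /eqP ->.
Qed.

Lemma malgUM (mo1 mo2 : cmonom (dgen n m)) :
  << mo1 >> * << mo2 >> = << mmul mo1 mo2 >> :> dpoly Phi n m.
Proof. by have := fgmulUU (R:=Phi) 1 1 mo1 mo2; rewrite mulr1. Qed.

Lemma dmonM l (mo1 mo2 : cmonom (dgen n m)) :
  dm l (mmul mo1 mo2) = dm l mo1 * << mo2 >> + << mo1 >> * dm l mo2.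
Proof.
rewrite [dm l mo1](dmonEw _ (fsubsetUl _ (finsupp mo2))).
rewrite [dm l mo2](dmonEw _ (fsubsetUr (finsupp mo1) _)).
have sub12 : (finsupp (mmul mo1 mo2) `<=` finsupp mo1 `|` finsupp mo2)%fset.
  by rewrite mdomD fsubset_refl.
rewrite (dmonEw _ sub12) sum_leibniz.
apply: eq_bigr => g _; rewrite (cmM g mo1 mo2).
apply: leibniz_term; rewrite cmE_neq0 => gmo; rewrite malgUM; congr << _ >>.
  exact: divcm_mull.
by rewrite (mulmC mo1 mo2) (divcm_mull mo1 gmo) (mulmC mo1).
Qed.

Lemma malgUZ c (mo : cmonom (dgen n m)) :
  << c *g mo >> = c *: << mo >> :> dpoly Phi n m.
Proof.
have H (K : choiceType) (R : nzRingType) (x : R) (k : K) :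
  << x *g k >> = x *: << k >> :> {malg R[K]}.
  apply/malgP => k'.
  rewrite mcoeffZ.
  rewrite !mcoeffU.
  by rewrite mulrnAr mulr1.
exact: H.
Qed.

Lemma dpoly_ind (P : dpoly Phi n m -> Prop) :
    P 0 -> (forall p q, P p -> P q -> P (p + q)) ->
    (forall c mo, P (c *: << mo >>)) ->
  forall p, P p.
Proof.
move=> P0 PD PU p; rewrite (monalgE p).
by apply: (big_ind P P0 PD) => mo _; rewrite malgUZ; apply: PU.
Qed.

Lemma deltaZU l c mo : delta l (c *: << mo >> : dpoly Phi n m) = c *: dm l mo.
Proof. by rewrite -malgUZ deltaU. Qed.

Lemma deltaM l p q : delta l (p * q) = delta l p * q + p * delta l q.
Proof.
have dU (mo : cmonom (dgen n m)) : delta l (<< mo >> : dpoly Phi n m) = dm l mo.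
  by rewrite deltaU scale1r.
apply: (@leibniz_span _ _ _ (fun mo => << mo >> : dpoly Phi n m)) => {p q}.
- exact: dpoly_ind.
- exact: delta0.
- exact: deltaD.
- by move=> c t; rewrite deltaZU dU.
- by move=> c t1 t2; rewrite malgUM deltaZU dU.
- move=> t1 t2.
  have H : delta l (<< t1 >> * << t2 >> : dpoly Phi n m) = dm l (mmul t1 t2).
    by rewrite malgUM dU.
  refine (etrans H _).
  refine (etrans (dmonM l t1 t2) _).
  by rewrite -(dU t1) -(dU t2).
Qed.

Lemma delta_dvar l g : delta l (dvar Phi g) = dvar Phi (dshift l g).
Proof.
rewrite /dvar deltaU scale1r /dmon mdomU big_seq_fset1 cmUU mulr1n.
have -> : divcm (ucm g) (ucm g) = mone.
  by apply/eqP/cmP => i; rewrite divcmE subnn cm1.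
by rewrite malgUM mul1m.
Qed.

Lemma mon_prod (gs : seq (dgen n m)) :
  << mon gs >> = \prod_(g <- gs) dvar Phi g :> dpoly Phi n m.
Proof.
elim: gs => [|g gs IH]; first by rewrite big_nil.
by rewrite big_cons -IH malgUM.
Qed.

End Derivation.

(** * Counter machines and their differential ideals *)

Definition upd (s : nat -> nat) (r v : nat) : nat -> nat :=
  fun k => if k == r then v else s k.

Inductive instr : Type :=
| IInc of nat
| IDec of nat
| IJz of nat & nat
| IJmp of nat.

Definition config := (nat * (nat -> nat))%type.

(** Outside the program the default instruction jumps to [size P], so [step] is total and a halted
    configuration stays halted. *)
Definition step (P : seq instr) (x : config) : config :=
  match nth (IJmp (size P)) P x.1 with
  | IInc c => (x.1.+1, upd x.2 c (x.2 c).+1)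
  | IDec c => (x.1.+1, upd x.2 c (x.2 c).-1)
  | IJz c j => if x.2 c == 0%N then (j, x.2) else (x.1.+1, x.2)
  | IJmp j => (j, x.2)
  end.

Definition halts (P : seq instr) (x : config) : Prop :=
  exists k, (size P <= (iter k (step P) x).1)%N.

Section Running.
Variable P : seq instr.

Lemma halts_step x : halts P (step P x) <-> halts P x.
Proof.
split=> -[k Hk]; first by exists k.+1; rewrite iterSr.
case: k Hk => [|k] Hk; last by exists k; rewrite -iterSr.
by exists 0%N; rewrite /= /step nth_default.
Qed.

(** Halting is not decidable, so this indicator comes from excluded middle. It only enters the
    definition of the separating functional, never an algorithm. *)
Definition running (x : config) : bool :=
  if excluded_middle_informative (halts P x) then false else true.

Lemma runningP x : reflect (~ halts P x) (running x).
Proof.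
by rewrite /running; case: excluded_middle_informative => H; constructor => //; apply.
Qed.

Lemma running_step x : running (step P x) = running x.
Proof. by apply/runningP/runningP; rewrite halts_step. Qed.

Lemma running_halt x : (size P <= x.1)%N -> running x = false.
Proof. by move=> Px; apply/runningP; apply; exists 0%N. Qed.

End Running.

Definition ireg (i : instr) : nat :=
  match i with IInc c | IDec c | IJz c _ => c | IJmp _ => 0%N end.

Lemma scalable_span (R : comNzRingType) (V : lmodType R) (T : Type)
    (e : T -> V) (L : V -> R) (w : T -> R) :
    (forall Q : V -> Prop, Q 0 -> (forall p q, Q p -> Q q -> Q (p + q)) ->
      (forall c t, Q (c *: e t)) -> forall p, Q p) ->
    L 0 = 0 -> {morph L : p q / p + q} ->
    (forall c t, L (c *: e t) = c * w t) ->
  forall c p, L (c *: p) = c * L p.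
Proof.
move=> ind L0 LD LZ c p; elim/ind: p => [|p q IHp IHq|d t].
- by rewrite scaler0 L0 mulr0.
- by rewrite scalerDr !LD IHp IHq mulrDr.
- by rewrite scalerA !LZ mulrA.
Qed.

Lemma kernel_span (R : comNzRingType) (A : comAlgType R) (T : Type)
    (e : T -> A) (L : A -> R) (g : A) :
    (forall Q : A -> Prop, Q 0 -> (forall p q, Q p -> Q q -> Q (p + q)) ->
      (forall c t, Q (c *: e t)) -> forall p, Q p) ->
    L 0 = 0 -> {morph L : p q / p + q} -> (forall c p, L (c *: p) = c * L p) ->
    (forall t, L (e t * g) = 0) ->
  forall r, L (r * g) = 0.
Proof.
move=> ind L0 LD LZ Lg r; elim/ind: r => [|p q IHp IHq|c t].
- by rewrite mul0r L0.
- by rewrite mulrDl LD IHp IHq addr0.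
- by rewrite -scalerAl LZ Lg mulr0.
Qed.

Lemma mulrBr_scale (R : comNzRingType) (A : comAlgType R) (r x y : A) :
  r * (x - y) = r * x + -1 *: (r * y).
Proof. by rewrite mulrBr scaleN1r. Qed.

Lemma big_prod3 (R : comNzRingType) (I : Type) (F : I -> R) x y t :
  \prod_(i <- [:: x; y; t]) F i = F x * F y * F t.
Proof. by rewrite !big_cons big_nil mulr1 mulrA. Qed.

(** * Halting runs stay inside a differential ideal *)

Section RunsInIdeal.
Variables (R : comNzRingType) (S : R -> Prop) (d : R -> R).
Variables (P : seq instr) (B : nat) (q z : nat -> R) (a : nat -> nat -> R).
Hypothesis SD : forall x y, S x -> S y -> S (x + y).
Hypothesis SM : forall r x, S x -> S (r * x).
Hypothesis Sd : forall x, S x -> S (d x).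
Hypothesis dD : {morph d : x y / x + y}.
Hypothesis dM : forall x y, d (x * y) = d x * y + x * d y.
Hypothesis da : forall c k, d (a c k) = a c k.+1.
Hypothesis Sdq : forall i, S (d (q i)).
Hypothesis Shalt : forall i, (size P <= i)%N -> S (q i).
Hypothesis Srel : forall i, (i < size P)%N ->
  match nth (IJmp (size P)) P i with
  | IInc c => (c < B)%N /\ S (q i * a c 0 - q i.+1 * a c 1)
  | IDec c => [/\ (c < B)%N, S (q i * a c 1 - q i.+1 * a c 0) &
                S (q i * a c 0 * z c - q i.+1 * a c 0 * z c)]
  | IJz c j => [/\ (c < B)%N, S (q i * a c 1 - q i.+1 * a c 1) &
                 S (q i * a c 0 * z c - q j * a c 0 * z c)]
  | IJmp j => S (q i - q j)
  end.

Definition cval (x : config) : R :=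
  \prod_(c <- iota 0 B) a c (x.2 c) * (q x.1 * \prod_(c <- iota 0 B) z c).

Let SB x y : S x -> S y -> S (x - y).
Proof. by move=> Sx Sy; rewrite -mulN1r; apply: SD => //; apply: SM. Qed.

(** Applying [d] raises both orders of [a] by one, up to multiples of [d (q i)] and [d (q j)], which
    lie in [S]. A single relation thus serves all larger counter values. *)
Lemma shift_rel i j c k0 k1 k :
  S (q i * a c k0 - q j * a c k1) -> S (q i * a c (k0 + k) - q j * a c (k1 + k)).
Proof.
move=> Sij; elim: k => [|k IH]; first by rewrite !addn0.
have d0 : d 0 = 0 by apply: (addrI (d 0)); rewrite -dD !addr0.
have dN x : d (- x) = - d x by apply: (addrI (d x)); rewrite -dD !subrr d0.
have := Sd IH; rewrite dD dN !dM !da !addnS => Sdk.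
have := SB (SD Sdk (SM (a c (k1 + k)) (Sdq j))) (SM (a c (k0 + k)) (Sdq i)).
by congr S; ring.
Qed.

(** An instruction acts on the state and one counter only; [T], which depends on neither, is the
    cofactor shared by the configurations before and after the step. *)
Lemma cval_split c s : (c < B)%N ->
  exists T, forall i k, cval (i, upd s c k) = T * (q i * a c k * z c).
Proof.
move=> cB; have ci : c \in iota 0 B by rewrite mem_iota.
exists (\prod_(c' <- iota 0 B | c' != c) a c' (s c') *
        \prod_(c' <- iota 0 B | c' != c) z c') => i k.
rewrite /cval /= !(bigD1_seq c) ?iota_uniq //= {1}/upd eqxx.
rewrite (eq_bigr (fun c' => a c' (s c'))) => [|c' c'c].
  by ring.
by rewrite /upd (negPf c'c).
Qed.

Lemma upd_same s c : upd s c (s c) = s.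
Proof. by apply: functional_extensionality => k; rewrite /upd; case: eqP => [->|]. Qed.

Lemma cval_step x : S (cval x - cval (step P x)).
Proof.
have Sfac T u v : S (u - v) -> S (T * u - T * v) by rewrite -mulrBr; apply: SM.
have S0 : S (0 : R) by rewrite -(mul0r (q (size P))); apply/SM/Shalt.
have Sz c u v : S (u - v) -> S (u * z c - v * z c).
  by rewrite -!(mulrC (z c)); apply: Sfac.
case: x => i s; case: (ltnP i (size P)) => [iP|Pi]; last first.
  (* Past the end the step leads to state [size P] with the same counters, and both state variables
     lie in [S]. *)
  rewrite /step nth_default //= /cval /= -mulrBr -mulrBl.
  by apply: SM; rewrite mulrC; apply: SM; apply: SB; apply: Shalt.
have := Srel iP; rewrite /step /=; case: (nth _ P i) => [c|c|c j|j].
- case=> cB rel; have [T eT] := cval_split s cB.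
  rewrite -{1}[s](upd_same s c) !eT; apply/Sfac/Sz.
  by have := shift_rel (s c) rel; rewrite add0n add1n.
- case=> cB rel rel0; have [T eT] := cval_split s cB.
  rewrite -{1}[s](upd_same s c) !eT; apply: Sfac.
  case: (s c) => [|k] //=; apply: Sz.
  by have := shift_rel k rel; rewrite add0n add1n.
- case=> cB rel rel0; have [T eT] := cval_split s cB.
  case: ifP => [/eqP sc|sc]; rewrite -[s](upd_same s c) !eT; apply: Sfac.
    by rewrite sc.
  apply: Sz; case: (s c) sc => // k _.
  by have := shift_rel k rel; rewrite add1n.
- move=> rel; rewrite /cval /=; apply: (Sfac).
  by rewrite -!(mulrC (\prod_(c <- _) z c)); apply: Sfac.
Qed.

Lemma cval_halts x : halts P x -> S (cval x).
Proof.
case=> k; elim: k x => [|k IH] x.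
  by move=> Px; rewrite /cval; apply: SM; rewrite mulrC; apply/SM/Shalt.
rewrite iterSr => /IH Sx; have := SD (cval_step x) Sx.
by rewrite subrK.
Qed.

End RunsInIdeal.

(** * The generators attached to a machine *)

Section Encoding.
Variables (Phi : comNzRingType) (m : nat) (P : seq instr) (B : nat).
Hypothesis B_size : (size P < B)%N.
Hypothesis B_reg : all (fun i => ireg i < B)%N P.

(* The variables A_c, Z_c, Q_i have indices 3c, 3c+1, 3i+2; the successor form
   is what [inord] needs. *)
Definition nvars := (3 * B).-1.+1.

Local Notation gen := (dgen nvars m.+1).
Local Notation poly := (dpoly Phi nvars m.+1).

Definition vexp (k : nat) : {ffun 'I_m.+1 -> nat} :=
  [ffun l => if l == ord0 then k else 0%N].

Definition gA (c k : nat) : gen := (inord (3 * c), vexp k).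
Definition gZ (c : nat) : gen := (inord (3 * c).+1, vexp 0).
(* All program counters past the end of P denote halting and share a variable. *)
Definition gQ (i k : nat) : gen := (inord (3 * minn i (size P)).+2, vexp k).

(** A relation without Z is meant to be differentiated, so it is stated at the least counter value
    it covers: order 0 of A for an increment, order 1 where the counter must be positive. A relation
    with Z covers the value 0 alone; for [IDec] it expresses that the decrement leaves 0
    unchanged. *)
Definition irels (i : nat) (ins : instr) : seq (seq gen * seq gen) :=
  match ins with
  | IInc c => [:: ([:: gQ i 0; gA c 0], [:: gQ i.+1 0; gA c 1])]
  | IDec c => [:: ([:: gQ i 0; gA c 1], [:: gQ i.+1 0; gA c 0]);
                  ([:: gQ i 0; gA c 0; gZ c], [:: gQ i.+1 0; gA c 0; gZ c])]
  | IJz c j => [:: ([:: gQ i 0; gA c 1], [:: gQ i.+1 0; gA c 1]);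
                  ([:: gQ i 0; gA c 0; gZ c], [:: gQ j 0; gA c 0; gZ c])]
  | IJmp j => [:: ([:: gQ i 0], [:: gQ j 0])]
  end.

Definition rels : seq (seq gen * seq gen) :=
  flatten [seq irels i (nth (IJmp (size P)) P i) | i <- iota 0 (size P)].

(** The first entry puts the halting state into the ideal; the others make every state variable a
    constant for the fixed derivation. *)
Definition zeros : seq (seq gen) :=
  [:: gQ (size P) 0] :: [seq [:: gQ i 1] | i <- iota 0 (size P).+1].

Definition order (g : gen) : nat := (\sum_l g.2 l)%N.

Lemma order_vexp (i : 'I_nvars) k : order (i, vexp k) = k.
Proof.
rewrite /order (bigD1 ord0) //= ffunE eqxx big1 ?addn0 // => l l0.
by rewrite ffunE (negPf l0).
Qed.

Lemma order_dshift l g : order (dshift l g) = (order g).+1.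
Proof.
rewrite /order /dshift /= (bigD1 l) //= [in RHS](bigD1 l) //= ffunE eqxx.
rewrite addn1 addSn; congr (_ + _).+1.
by apply: eq_bigr => j jl; rewrite ffunE (negPf jl) addn0.
Qed.

Lemma dshift_vexp (i : 'I_nvars) k :
  dshift ord0 (i, vexp k) = (i, vexp k.+1).
Proof.
rewrite /dshift /=; congr (_, _); apply/ffunP => l; rewrite !ffunE.
by case: eqP => _; rewrite ?addn1 ?addn0.
Qed.

(** Decoding of the variable index 3k + e: the residue is 0 for A, 1 for Z and 2 for Q, and the
    quotient is the counter or the state. *)
Definition kind (g : gen) : nat := (g.1 %% 3)%N.
Definition idx (g : gen) : nat := (g.1 %/ 3)%N.

Lemma kindP g : [\/ kind g = 0%N, kind g = 1%N | kind g = 2%N].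
Proof.
rewrite /kind; have : (g.1 %% 3 < 3)%N by apply: ltn_pmod.
by case: (g.1 %% 3)%N => [|[|[|//]]] _; [apply: Or31|apply: Or32|apply: Or33].
Qed.

Lemma idx_lt g : (idx g < B)%N.
Proof. by rewrite /idx; case: g => -[i /= lti] _; rewrite /nvars in lti; lia. Qed.

Lemma kind_dshift l g : kind (dshift l g) = kind g. Proof. by []. Qed.
Lemma idx_dshift l g : idx (dshift l g) = idx g. Proof. by []. Qed.

Lemma gA_spec c k : (c < B)%N ->
  [/\ kind (gA c k) = 0%N, idx (gA c k) = c & order (gA c k) = k].
Proof.
move=> cB; rewrite order_vexp /kind /idx /gA /= inordK; last by rewrite /nvars; lia.
by split => //; lia.
Qed.

Lemma gZ_spec c : (c < B)%N ->
  [/\ kind (gZ c) = 1%N, idx (gZ c) = c & order (gZ c) = 0%N].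
Proof.
move=> cB; rewrite order_vexp /kind /idx /gZ /= inordK; last by rewrite /nvars; lia.
by split => //; lia.
Qed.

Lemma gQ_spec i k :
  [/\ kind (gQ i k) = 2%N, idx (gQ i k) = minn i (size P) & order (gQ i k) = k].
Proof.
rewrite order_vexp /kind /idx /gQ /= inordK; last by rewrite /nvars; lia.
by split => //; lia.
Qed.

(** * Shape, state and counters read off a monomial *)

Definition at_A c g : nat := (kind g == 0%N) && (idx g == c).
Definition at_Z c g : nat := (kind g == 1%N) && (idx g == c).
Definition plain_Q g : nat := (kind g == 2%N) && (order g == 0%N).
Definition derived_Q g : nat := (kind g == 2%N) && (order g != 0%N).
Definition pc_of g : nat := ((kind g == 2%N) * idx g)%N.
Definition order_at c g : nat := (((kind g != 2%N) && (idx g == c)) * order g)%N.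
Definition order_Z g : nat := ((kind g == 1%N) * order g)%N.

Local Notation C := (running P).
Let C_step := @running_step P.
Let C_halt := @running_halt P.

(** The monomials on which the functional may be nonzero: for each counter one factor A and one
    factor Z, derived to any order, and exactly one state variable, not derived. *)
Definition degok (mo : cmonom gen) : bool :=
  [&& all (fun c => (weight (at_A c) mo == 1%N) && (weight (at_Z c) mo == 1%N))
        (iota 0 B), weight plain_Q mo == 1%N & weight derived_Q mo == 0%N].

Definition regs (mo : cmonom gen) : nat -> nat := fun c => weight (order_at c) mo.

(* The sign and [regs] implement A_c^(a) Z_c^(z) |-> (-1)^z A_c^(a+z); the
   derivations are not distinguished, only total orders matter. *)
Definition lam (mo : cmonom gen) : Phi :=
  if degok mo && C (weight pc_of mo, regs mo) then (-1) ^+ weight order_Z mo else 0.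

Lemma eq_degok (mo1 mo2 : cmonom gen) :
  (forall c, (c < B)%N -> weight (at_A c) mo1 = weight (at_A c) mo2) ->
  (forall c, (c < B)%N -> weight (at_Z c) mo1 = weight (at_Z c) mo2) ->
  weight plain_Q mo1 = weight plain_Q mo2 ->
  weight derived_Q mo1 = weight derived_Q mo2 ->
  degok mo1 = degok mo2.
Proof.
move=> eA eZ eQ eD; rewrite /degok eQ eD; congr (_ && _).
by apply: eq_in_all => c; rewrite mem_iota => /andP[_ cB]; rewrite eA // eZ.
Qed.

Lemma weightMmon h (r : cmonom gen) gs :
  weight h (mmul r (mon gs)) = (weight h r + \sum_(g <- gs) h g)%N.
Proof. by rewrite weightM weight_mon. Qed.

Lemma C_minn i s : C (minn i (size P), s) = C (i, s).
Proof.
by case: leqP => // iP; rewrite !C_halt //= ltnW.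
Qed.

Lemma weights_gA c' k : (c' < B)%N -> forall c,
  ((at_A c (gA c' k) = (c' == c)) * (at_Z c (gA c' k) = 0%N) *
   (plain_Q (gA c' k) = 0%N) * (derived_Q (gA c' k) = 0%N) * (pc_of (gA c' k) = 0%N) *
   (order_at c (gA c' k) = (c' == c) * k)%N * (order_Z (gA c' k) = 0%N))%type.
Proof.
move=> cB c; have [ek ei eo] := gA_spec k cB.
by rewrite /at_A /at_Z /plain_Q /derived_Q /pc_of /order_at /order_Z ek ei eo.
Qed.

Lemma weights_gZ c' : (c' < B)%N -> forall c,
  ((at_A c (gZ c') = 0%N) * (at_Z c (gZ c') = (c' == c)) *
   (plain_Q (gZ c') = 0%N) * (derived_Q (gZ c') = 0%N) * (pc_of (gZ c') = 0%N) *
   (order_at c (gZ c') = 0)%N * (order_Z (gZ c') = 0%N))%type.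
Proof.
move=> cB c; have [ek ei eo] := gZ_spec cB.
by rewrite /at_A /at_Z /plain_Q /derived_Q /pc_of /order_at /order_Z ek ei eo muln0.
Qed.

Lemma weights_gQ i k c :
  ((at_A c (gQ i k) = 0%N) * (at_Z c (gQ i k) = 0%N) *
   (plain_Q (gQ i k) = (k == 0%N)) * (derived_Q (gQ i k) = (k != 0%N)) *
   (pc_of (gQ i k) = minn i (size P)) *
   (order_at c (gQ i k) = 0)%N * (order_Z (gQ i k) = 0%N))%type.
Proof.
have [ek ei eo] := gQ_spec i k.
by rewrite /at_A /at_Z /plain_Q /derived_Q /pc_of /order_at /order_Z ek ei eo mul1n.
Qed.

Lemma weight_eq0_two h1 h2 h (mo : cmonom gen) :
  (forall g, h1 g = 0%N -> h2 g = 0%N -> h g = 0%N) ->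
  weight h1 mo = 0%N -> weight h2 mo = 0%N -> weight h mo = 0%N.
Proof.
move=> hh e1 e2; apply: (@weight_eq0 _ _ (fun g => h1 g + h2 g)%N).
  by move=> g /eqP; rewrite addn_eq0 => /andP[/eqP ? /eqP ?]; apply: hh.
rewrite /weight; under eq_bigr do rewrite mulnDr.
by rewrite big_split /= -/(weight h1 mo) -/(weight h2 mo) e1 e2.
Qed.

Lemma weight_pc_of0 (mo : cmonom gen) :
  weight plain_Q mo = 0%N -> weight derived_Q mo = 0%N ->
  weight pc_of mo = 0%N.
Proof.
apply: weight_eq0_two => g; rewrite /plain_Q /derived_Q /pc_of.
by case: (kind g == 2%N) => //=; case: (order g == 0%N).
Qed.

Lemma weight_order_at0 c (mo : cmonom gen) :
  weight (at_A c) mo = 0%N -> weight (at_Z c) mo = 0%N ->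
  weight (order_at c) mo = 0%N.
Proof.
apply: weight_eq0_two => g; rewrite /at_A /at_Z /order_at.
by case: (kindP g) => -> //=; case: (idx g == c).
Qed.

Lemma lam_eq (r : cmonom gen) gs1 gs2 :
  (forall c, (c < B)%N -> \sum_(g <- gs1) at_A c g = \sum_(g <- gs2) at_A c g)%N ->
  (forall c, (c < B)%N -> \sum_(g <- gs1) at_Z c g = \sum_(g <- gs2) at_Z c g)%N ->
  (\sum_(g <- gs1) plain_Q g = 1)%N -> (\sum_(g <- gs2) plain_Q g = 1)%N ->
  (\sum_(g <- gs1) derived_Q g = \sum_(g <- gs2) derived_Q g)%N ->
  (\sum_(g <- gs1) order_Z g = \sum_(g <- gs2) order_Z g)%N ->
  (degok (mmul r (mon gs1)) ->
     C (\sum_(g <- gs1) pc_of g,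
        fun c => weight (order_at c) r + \sum_(g <- gs1) order_at c g)%N =
     C (\sum_(g <- gs2) pc_of g,
        fun c => weight (order_at c) r + \sum_(g <- gs2) order_at c g)%N) ->
  lam (mmul r (mon gs1)) = lam (mmul r (mon gs2)).
Proof.
move=> eA eZ eQ1 eQ2 eD eS eC.
have eok : degok (mmul r (mon gs1)) = degok (mmul r (mon gs2)).
  by apply: eq_degok => [c cB|c cB||]; rewrite !weightMmon ?eA ?eZ ?eQ1 ?eQ2 ?eD.
rewrite /lam -eok; case ok: (degok _) => //=; rewrite !weightMmon eS.
(* The admissible shape allows one state variable, which [gs1] already supplies. Hence [r] contains
   none, and the state of the product is that of the list. *)
have rP : weight pc_of r = 0%N.
  move: ok => /and3P[_ /eqP]; rewrite !weightMmon eQ1 addn1 => -[rQ].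
  by rewrite addn_eq0 => /andP[/eqP rD _]; apply: weight_pc_of0.
have regsM gs : regs (mmul r (mon gs)) =
    (fun c => weight (order_at c) r + \sum_(g <- gs) order_at c g)%N.
  by apply: functional_extensionality => c; rewrite /regs weightMmon.
by rewrite rP !add0n !regsM eC.
Qed.

Lemma degok_AZ (mo : cmonom gen) c : degok mo -> (c < B)%N ->
  weight (at_A c) mo = 1%N /\ weight (at_Z c) mo = 1%N.
Proof.
move=> /and3P[/allP okc _ _] cB; have /okc : c \in iota 0 B by rewrite mem_iota.
by case/andP => /eqP ? /eqP.
Qed.

Lemma lam_irels i (r : cmonom gen) p : (i < size P)%N ->
  p \in irels i (nth (IJmp (size P)) P i) ->
  lam (mmul r (mon p.1)) = lam (mmul r (mon p.2)).
Proof.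
move=> iP; have Ci s := C_step (i, s); rewrite /step /= in Ci.
have /(all_nthP (IJmp (size P))) /(_ i iP) := B_reg.
have C_min j s : C (minn j (size P), s) = C (j, s) by apply: C_minn.
(* With A and Z of counter [c] both present and not derived, the shape leaves no derivative of
   either in [r]. The counter is therefore exactly 0, as a zero test requires. *)
have rT0 (c : nat) gs : (c < B)%N -> degok (mmul r (mon [:: gs; gA c 0; gZ c])) ->
    weight (order_at c) r = 0%N.
  move=> cB /degok_AZ /(_ cB).
  rewrite !weightMmon ?big_cons ?big_nil ?weights_gA ?weights_gZ //.
  rewrite eqxx /= !addn0 !add0n !addnA !addn1 => -[[/eqP rA] [/eqP rZ]].
  move: rA rZ; rewrite !addn_eq0 => /andP[/eqP rA _] /andP[/eqP rZ _].
  exact: weight_order_at0.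
case: (nth _ P i) Ci => [c|c|c j|j] /= Ci cB.
- rewrite inE => /eqP -> /=; apply: lam_eq.
  all: try by move=> *; rewrite ?big_cons ?big_nil ?weights_gA ?weights_gQ.
  move=> _; rewrite ?big_cons ?big_nil ?weights_gA ?weights_gQ // !addn0 !C_min -Ci.
  congr (C (_, _)); apply: functional_extensionality => c'.
  rewrite /upd !big_cons !big_nil !weights_gA // !weights_gQ eqxx [c == c']eq_sym.
  by case: eqP => [->|_]; lia.
- rewrite !inE => /orP[] /eqP -> /=; apply: lam_eq.
  all: try by move=> *; rewrite ?big_cons ?big_nil ?weights_gA ?weights_gQ ?weights_gZ.
    move=> _; rewrite ?big_cons ?big_nil ?weights_gA ?weights_gQ // !addn0 !C_min -Ci.
    congr (C (_, _)); apply: functional_extensionality => c'.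
    rewrite /upd !big_cons !big_nil !weights_gA // !weights_gQ eqxx [c == c']eq_sym.
    by case: eqP => [->|_]; lia.
  move=> /(rT0 _ _ cB) c0.
  rewrite ?big_cons ?big_nil ?weights_gA ?weights_gQ ?weights_gZ // !addn0 !C_min -Ci.
  congr (C (_, _)); apply: functional_extensionality => c'.
  rewrite /upd !big_cons !big_nil !weights_gA // !weights_gQ !weights_gZ //.
  rewrite c0 [c == c']eq_sym.
  by case: eqP => [->|_]; lia.
- rewrite !inE => /orP[] /eqP -> /=; apply: lam_eq.
  all: try by move=> *; rewrite ?big_cons ?big_nil ?weights_gA ?weights_gQ ?weights_gZ.
    move=> _; rewrite ?big_cons ?big_nil ?weights_gA ?weights_gQ // !addn0 !C_min -Ci.
    rewrite !big_cons !big_nil !weights_gA // !weights_gQ eqxx addnS /=.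
    congr (C (_, _)); apply: functional_extensionality => c'.
    by rewrite !big_cons !big_nil !weights_gA // !weights_gQ.
  move=> /(rT0 _ _ cB) c0.
  rewrite ?big_cons ?big_nil ?weights_gA ?weights_gQ ?weights_gZ // !addn0 !C_min -Ci.
  rewrite !big_cons !big_nil !weights_gA // !weights_gQ !weights_gZ // c0 eqxx /=.
  congr (C (_, _)); apply: functional_extensionality => c'.
  by rewrite !big_cons !big_nil !weights_gA // !weights_gQ !weights_gZ.
- rewrite inE => /eqP -> /=; apply: lam_eq.
  all: try by move=> *; rewrite ?big_cons ?big_nil ?weights_gQ.
  move=> _; rewrite ?big_cons ?big_nil ?weights_gQ // !addn0 !C_min -Ci.
  congr (C (_, _)); apply: functional_extensionality => c'.
  by rewrite !big_cons !big_nil !weights_gQ.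
Qed.

(** The halting state makes the configuration not running, and a derived state variable violates the
    admissible shape. *)
Lemma lam_zeros (r : cmonom gen) gs : gs \in zeros -> lam (mmul r (mon gs)) = 0.
Proof.
rewrite inE => /orP[/eqP ->|/mapP[i _ ->]]; rewrite /lam.
  case ok: (degok _) => //=; rewrite C_halt //= weightMmon big_cons.
  by rewrite (weights_gQ _ _ 0) minnn addnCA leq_addr.
rewrite /degok (weightMmon derived_Q) big_cons big_nil (weights_gQ _ _ 0) addn0 addn1.
by rewrite !andbF.
Qed.

(** The value of the functional after raising counter [c] by one, with the sign of [mo] kept. *)
Definition shifted (mo : cmonom gen) (c : nat) : Phi :=
  if degok mo && C (weight pc_of mo, fun c' => regs mo c' + (c' == c))%N
  then (-1) ^+ weight order_Z mo else 0.

(** Deriving a state variable destroys the shape. Deriving an A or a Z raises its counter by one,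
    and Z also flips the sign. Only the term for [idx g] survives in the sum, which is written over
    all counters so that it can be exchanged with the sum over [g]. *)
Lemma lam_shift l (mo : cmonom gen) g : g \in finsupp mo ->
  lam (mmul (divcm mo (ucm g)) (ucm (dshift l g))) =
  \sum_(c <- iota 0 B) ((at_A c g)%:R - (at_Z c g)%:R) * shifted mo c.
Proof.
move=> gmo; set r := divcm mo (ucm g).
have mowt h : weight h mo = (weight h r + h g)%N.
  by rewrite -[in LHS](divcmK gmo) weightM weightU.
have wt h : weight h (mmul r (ucm (dshift l g))) = (weight h r + h (dshift l g))%N.
  by rewrite weightM weightU.
have [k2|k2] := eqVneq (kind g) 2%N.
  rewrite big1_seq; last by move=> c _; rewrite /at_A /at_Z k2 subrr mul0r.
  rewrite /lam /degok (wt derived_Q) /derived_Q kind_dshift k2.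
  by rewrite order_dshift addn1 !andbF.
have ok : degok (mmul r (ucm (dshift l g))) = degok mo.
  apply: eq_degok => [c _|c _||]; rewrite wt mowt //.
    by rewrite /plain_Q kind_dshift (negPf k2).
  by rewrite /derived_Q kind_dshift (negPf k2).
have -> : lam (mmul r (ucm (dshift l g))) =
    (-1) ^+ (kind g == 1%N) * shifted mo (idx g).
  rewrite /lam /shifted ok.
  have -> : weight pc_of (mmul r (ucm (dshift l g))) = weight pc_of mo.
    by rewrite wt mowt.
  have -> : regs (mmul r (ucm (dshift l g))) =
      (fun c' => regs mo c' + (c' == idx g))%N.
    apply: functional_extensionality => c; rewrite /regs wt mowt /order_at.
    rewrite kind_dshift idx_dshift order_dshift k2 eq_sym /= mulnS -addnA.
    by congr (_ + _)%N; rewrite addnC.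
  case: ifP => _; last by rewrite mulr0.
  rewrite wt mowt /order_Z kind_dshift order_dshift mulnS addnCA exprD.
  by case: (kind g == 1%N).
rewrite (bigD1_seq (idx g)) ?iota_uniq ?mem_iota ?idx_lt //=.
rewrite big1 => [|c cg]; last first.
  by rewrite /at_A /at_Z [idx g == c]eq_sym (negPf cg) !andbF subrr mul0r.
rewrite addr0 /at_A /at_Z eqxx !andbT.
by case: (kindP g) k2 => -> //= _; rewrite ?subr0 ?sub0r.
Qed.

(* Deriving A_c or Z_c moves to the same configuration with opposite signs, so
   the terms cancel because A_c and Z_c have the same degree. *)
Lemma lam_dmon_sum l (mo : cmonom gen) :
  \sum_(g <- finsupp mo)
    lam (mmul (divcm mo (ucm g)) (ucm (dshift l g))) *+ mo g = 0.
Proof.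
rewrite big_seq; under eq_bigr => g gmo do rewrite lam_shift // -sumrMnl.
rewrite -big_seq exchange_big /= big_seq big1 // => c; rewrite mem_iota => /andP[_ cB].
under eq_bigr do rewrite -mulrnAl mulrnBl -!mulrnA.
rewrite -mulr_suml sumrB -!natr_sum.
have sw h : (\sum_(g <- finsupp mo) h g * mo g)%N = weight h mo.
  by apply: eq_bigr => g _; rewrite mulnC.
rewrite !sw /shifted; case ok: (degok mo); last by rewrite mulr0.
by have [-> ->] := degok_AZ ok cB; rewrite subrr mul0r.
Qed.

(** * The linear functional and its vanishing on the ideal *)

Definition lamL (p : poly) : Phi := mmap idfun lam p.

Lemma lamL0 : lamL 0 = 0. Proof. exact: mmap0. Qed.
Lemma lamLD : {morph lamL : p q / p + q}. Proof. exact: mmapD. Qed.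
Lemma lamLMn k : {morph lamL : p / p *+ k}. Proof. exact: mmapMn. Qed.

Lemma lamLU (mo : cmonom gen) : lamL << mo >> = lam mo.
Proof. by rewrite /lamL mmapU mul1r. Qed.

Lemma lamLZU c (mo : cmonom gen) : lamL (c *: << mo >>) = c * lam mo.
Proof. by rewrite -malgUZ /lamL mmapU. Qed.

Lemma lamLZ c p : lamL (c *: p) = c * lamL p.
Proof.
apply: (scalable_span (e := fun mo => << mo >> : poly) (w := lam)).
- exact: dpoly_ind.
- exact: lamL0.
- exact: lamLD.
- exact: lamLZU.
Qed.

Lemma lamL_dmon l mo : lamL (dmon Phi l mo) = 0.
Proof.
rewrite /dmon (big_morph _ lamLD lamL0) -[RHS](lam_dmon_sum l mo).
by apply: eq_bigr => g _; rewrite lamLMn malgUM lamLU.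
Qed.

Lemma lamL_delta l p : lamL (delta l p) = 0.
Proof.
elim/dpoly_ind: p => [|p q IHp IHq|c mo]; first by rewrite delta0 lamL0.
  rewrite (deltaD l p q) (lamLD (delta l p)).
  exact: etrans (congr2 +%R IHp IHq) (addr0 0).
by rewrite (deltaZU l c mo) (lamLZ c (dmon Phi l mo)) lamL_dmon mulr0.
Qed.

(** The polynomials all of whose multiples are killed by [lamL] form a differential ideal: r
    delta(a) equals delta(r a) - delta(r) a, and [lamL] kills both delta(r a) and the multiple of
    a. *)
Lemma in_diff_ideal_lamL fs f :
  in_diff_ideal fs f ->
  (forall g, g \in fs -> forall r : cmonom gen, lamL (<< r >> * g) = 0) ->
  lamL f = 0.
Proof.
move=> ff fs0; rewrite -[f]mul1r; move: (1 : poly).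
pose S (p : poly) := forall r : poly, lamL (r * p) = 0.
apply: (ff S); rewrite {}/S.
- by move=> r; rewrite mulr0 lamL0.
- move=> a b Sa Sb r; rewrite (mulrDr r a b) (lamLD (r * a)).
  exact: etrans (congr2 +%R (Sa r) (Sb r)) (addr0 0).
- by move=> r a Sa r'; rewrite (mulrA r' r a).
- move=> l a Sa r; have := lamL_delta l (r * a).
  rewrite (deltaM l r a) (lamLD (delta l r * a)) => LE.
  exact: etrans (esym (add0r _)) (etrans (congr2 +%R (esym (Sa _)) erefl) LE).
- move=> g gfs r.
  apply: (kernel_span (L := lamL) (e := fun mo => << mo >> : poly)).
  + exact: dpoly_ind.
  + exact: lamL0.
  + exact: lamLD.
  + exact: lamLZ.
  + exact: fs0.
Qed.

(** * Membership of a configuration is equivalent to halting *)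

Definition mono (gs : seq gen) : seq (gen * nat) := [seq (g, 1%N) | g <- gs].
Definition mon_code (gs : seq gen) : dcode nvars m.+1 := [:: (1, mono gs)].
Definition rel_code (p : seq gen * seq gen) : dcode nvars m.+1 :=
  [:: (1, mono p.1); (-1, mono p.2)].

Definition machine_code : seq (dcode nvars m.+1) :=
  [seq rel_code p | p <- rels] ++ [seq mon_code gs | gs <- zeros].

Definition cgens (x : config) : seq gen :=
  [seq gA c (x.2 c) | c <- iota 0 B] ++
  gQ x.1 0 :: [seq gZ c | c <- iota 0 B].

Lemma dinterp_mono gs :
  \prod_(ge <- mono gs) dvar Phi ge.1 ^+ ge.2 = << mon gs >> :> poly.
Proof.
rewrite mon_prod /mono big_map /=.
by apply: eq_bigr.
Qed.

Lemma dinterp_mon gs : dinterp Phi (mon_code gs) = << mon gs >>.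
Proof.
rewrite /dinterp /mon_code big_seq1 dinterp_mono /=.
exact: mul1r.
Qed.

Lemma dinterp_rel p : dinterp Phi (rel_code p) = << mon p.1 >> - << mon p.2 >>.
Proof.
rewrite /dinterp /rel_code big_cons big_seq1 !dinterp_mono /=.
have e (R : nzRingType) (x y : R) : 1%:~R * x + (-1)%:~R * y = x - y.
  by rewrite mulr1z mul1r mulrN1z mulN1r.
exact: e.
Qed.

Lemma mon_cgens x : << mon (cgens x) >> =
  cval B (fun i => dvar Phi (gQ i 0)) (fun c => dvar Phi (gZ c))
    (fun c k => dvar Phi (gA c k)) x.
Proof. by rewrite mon_prod /cgens big_cat big_cons !big_map. Qed.

Lemma machine_codeP p :
  p \in map (dinterp Phi (m:=m.+1)) (machine_code) ->
  (exists2 gs, gs \in rels & p = << mon gs.1 >> - << mon gs.2 >>) \/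
  (exists2 gs, gs \in zeros & p = << mon gs >>).
Proof.
case/mapP => c; rewrite mem_cat => /orP[] /mapP[gs gsin ->] ->.
  by left; exists gs => //; rewrite dinterp_rel.
by right; exists gs => //; rewrite dinterp_mon.
Qed.

Lemma sum_iota_eq c : (c < B)%N -> (\sum_(c' <- iota 0 B) (c' == c) = 1)%N.
Proof.
move=> cB; rewrite (bigD1_seq c) ?iota_uniq ?mem_iota //= eqxx big1 // => c'.
by move/negPf => ->.
Qed.

Lemma weight_cgens x (h : gen -> nat) : weight h (mon (cgens x)) =
  (\sum_(c <- iota 0 B) h (gA c (x.2 c)) +
    (h (gQ x.1 0) + \sum_(c <- iota 0 B) h (gZ c)))%N.
Proof. by rewrite weight_mon /cgens big_cat big_cons !big_map. Qed.

(** The monomial of a configuration has the admissible shape and no derived Z, hence sign 1.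
    Counters from [B] on have no variable and are read as 0, so the hypothesis makes [regs] return
    exactly [x.2]. *)
Lemma lam_cgens x : (forall c, (B <= c)%N -> x.2 c = 0%N) -> running P x ->
  lam (mon (cgens x)) = 1.
Proof.
move=> x0 Rx.
have sA (f : gen -> nat) (h : nat -> nat) :
    (forall c k, (c < B)%N -> k = x.2 c -> f (gA c k) = h c) ->
    (\sum_(c <- iota 0 B) f (gA c (x.2 c)) = \sum_(c <- iota 0 B) h c)%N.
  by move=> fh; apply: eq_big_seq => c; rewrite mem_iota => /andP[_ /fh]; apply.
have sZ (f : gen -> nat) (h : nat -> nat) :
    (forall c, (c < B)%N -> f (gZ c) = h c) ->
    (\sum_(c <- iota 0 B) f (gZ c) = \sum_(c <- iota 0 B) h c)%N.
  by move=> fh; apply: eq_big_seq => c; rewrite mem_iota => /andP[_ /fh].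
have s0 : (\sum_(c <- iota 0 B) 0 = 0)%N by rewrite big1.
have wt0 (f : gen -> nat) : (forall c k, (c < B)%N -> f (gA c k) = 0%N) ->
    (forall c, (c < B)%N -> f (gZ c) = 0%N) ->
    weight f (mon (cgens x)) = f (gQ x.1 0).
  move=> fA fZ; rewrite weight_cgens (sA _ (fun=> 0%N)); last first.
    by move=> c k cB _; apply: fA.
  by rewrite (sZ _ (fun=> 0%N)) // s0 addn0.
have wA c : (c < B)%N -> weight (at_A c) (mon (cgens x)) = 1%N.
  move=> cB; rewrite weight_cgens (sA _ (fun c' => c' == c)); last first.
    by move=> c' k c'B _; rewrite (weights_gA k c'B c).
  rewrite (sZ _ (fun=> 0%N)); last by move=> c' c'B; rewrite (weights_gZ c'B c).
  by rewrite sum_iota_eq // s0 (weights_gQ _ _ c).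
have wZ c : (c < B)%N -> weight (at_Z c) (mon (cgens x)) = 1%N.
  move=> cB; rewrite weight_cgens (sA _ (fun=> 0%N)); last first.
    by move=> c' k c'B _; rewrite (weights_gA k c'B c).
  rewrite (sZ _ (fun c' => c' == c)); last by move=> c' c'B; rewrite (weights_gZ c'B c).
  by rewrite sum_iota_eq // s0 (weights_gQ _ _ c).
have wT : regs (mon (cgens x)) = x.2.
  apply: functional_extensionality => c; rewrite /regs weight_cgens.
  rewrite (sA _ (fun c' => (c' == c) * x.2 c')%N); last first.
    by move=> c' k c'B ->; rewrite (weights_gA _ c'B c).
  rewrite (sZ _ (fun=> 0%N)); last by move=> c' c'B; rewrite (weights_gZ c'B c).
  rewrite s0 (weights_gQ _ _ c) !addn0; case: (ltnP c B) => cB.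
    rewrite (bigD1_seq c) ?iota_uniq ?mem_iota //= eqxx mul1n big1 ?addn0 // => c'.
    by move/negPf => ->.
  rewrite x0 // big1_seq // => c'; rewrite mem_iota => /andP[_ c'B].
  by case: eqP c'B => [->|_ _]; rewrite ?mul0n // ltnNge cB.
have wQ : weight plain_Q (mon (cgens x)) = 1%N.
  by rewrite wt0 ?(weights_gQ _ _ 0) // => [c k cB|c cB];
     rewrite ?(weights_gA _ cB 0) ?(weights_gZ cB 0).
have wD : weight derived_Q (mon (cgens x)) = 0%N.
  by rewrite wt0 ?(weights_gQ _ _ 0) // => [c k cB|c cB];
     rewrite ?(weights_gA _ cB 0) ?(weights_gZ cB 0).
have wP : weight pc_of (mon (cgens x)) = minn x.1 (size P).
  by rewrite wt0 ?(weights_gQ _ _ 0) // => [c k cB|c cB];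
     rewrite ?(weights_gA _ cB 0) ?(weights_gZ cB 0).
have wS : weight order_Z (mon (cgens x)) = 0%N.
  by rewrite wt0 ?(weights_gQ _ _ 0) // => [c k cB|c cB];
     rewrite ?(weights_gA _ cB 0) ?(weights_gZ cB 0).
have ok : degok (mon (cgens x)).
  rewrite /degok wQ wD !andbT; apply/allP => c; rewrite mem_iota => /andP[_ cB].
  by rewrite wA // wZ.
rewrite /lam ok wP wS wT C_minn.
case: x Rx {x0 sA wt0 wA wZ wT wQ wD wP wS ok} => i s /= ->.
by rewrite expr0.
Qed.

Lemma in_ideal_halts x : (forall c, (B <= c)%N -> x.2 c = 0%N) ->
  in_diff_ideal (map (dinterp Phi (m:=m.+1)) machine_code) << mon (cgens x) >> ->
  halts P x.
Proof.
move=> x0 ix; apply: NNPP => /runningP Rx.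
have L0 : lamL (<< mon (cgens x) >> : poly) = 0.
  apply: (in_diff_ideal_lamL ix) => p /machine_codeP[[gs gsin ->]|[gs gsin ->]] r.
    have -> : << r >> * (<< mon gs.1 >> - << mon gs.2 >>) =
        << mmul r (mon gs.1) >> + -1 *: << mmul r (mon gs.2) >> :> poly.
      by rewrite -!malgUM; apply: mulrBr_scale.
    rewrite lamLD lamLU lamLZU mulN1r; apply/eqP; rewrite subr_eq0; apply/eqP.
    case/flattenP: gsin => rs /mapP[i]; rewrite mem_iota => /andP[_ iP] ->.
    exact: lam_irels.
  rewrite malgUM lamLU.
  exact: lam_zeros.
(* The functional is 1 on a running configuration, and 1 differs from 0 in [Phi]. *)
move: L0; rewrite lamLU lam_cgens // => /eqP.
by rewrite oner_eq0.
Qed.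

Lemma halts_in_ideal x : halts P x ->
  in_diff_ideal (map (dinterp Phi (m:=m.+1)) machine_code) << mon (cgens x) >>.
Proof.
move=> Hx S S0 SD SM Sd Sfs; rewrite mon_cgens.
pose M gs : poly := << mon gs >>.
have m1 g : M [:: g] = dvar Phi g by rewrite /M mon_prod big_seq1.
have m2 g g' : M [:: g; g'] = dvar Phi g * dvar Phi g'.
  by rewrite /M mon_prod big_cons big_seq1.
have m3 g g' g'' : M [:: g; g'; g''] = dvar Phi g * dvar Phi g' * dvar Phi g''.
  by rewrite /M mon_prod; apply: big_prod3.
have Szero gs : gs \in zeros -> S (M gs).
  move=> gsin; apply: Sfs; apply/mapP; exists (mon_code gs); last first.
    by rewrite dinterp_mon.
  by rewrite mem_cat orbC map_f.
have Srels i gs hs : (i < size P)%N ->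
    (gs, hs) \in irels i (nth (IJmp (size P)) P i) -> S (M gs - M hs).
  move=> iP pin; apply: Sfs; apply/mapP; exists (rel_code (gs, hs)).
    rewrite mem_cat map_f //; apply/flattenP; eexists; last exact: pin.
    by apply/mapP; exists i; rewrite // mem_iota.
  by rewrite dinterp_rel.
clearbody M.
apply: (cval_halts (S := S) (d := delta ord0) (P := P)) => //.
- exact: Sd.
- exact: deltaD.
- exact: deltaM.
- by move=> c k; rewrite delta_dvar dshift_vexp.
- move=> i; rewrite delta_dvar dshift_vexp -m1; apply: Szero.
  (* States past the end share one variable, so the finite list [zeros] covers every [i]. *)
  have -> : (inord (3 * minn i (size P)).+2, vexp 1) = gQ (minn i (size P)) 1.
    by rewrite /gQ -minnA minnn.
  by rewrite inE; apply/orP; right; apply: map_f; rewrite mem_iota ltnS geq_minr.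
- move=> i Pi; rewrite -m1; apply: Szero.
  by rewrite inE /gQ (minn_idPr Pi) minnn eqxx.
move=> i iP; have /(all_nthP (IJmp (size P))) /(_ i iP) := B_reg.
have SE (u v u' v' : poly) : u = u' -> v = v' -> S (u - v) -> S (u' - v').
  by move=> -> ->.
have S1 g h : ([:: g], [:: h]) \in irels i (nth (IJmp (size P)) P i) ->
    S (dvar Phi g - dvar Phi h).
  by move/(Srels _ _ _ iP) => H; exact: (SE _ _ _ _ (m1 g) (m1 h) H).
have S2 g g' h h' : ([:: g; g'], [:: h; h']) \in irels i (nth (IJmp (size P)) P i) ->
    S (dvar Phi g * dvar Phi g' - dvar Phi h * dvar Phi h').
  by move/(Srels _ _ _ iP) => H; exact: (SE _ _ _ _ (m2 g g') (m2 h h') H).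
have S3 g g' g'' h h' h'' :
    ([:: g; g'; g''], [:: h; h'; h'']) \in irels i (nth (IJmp (size P)) P i) ->
    S (dvar Phi g * dvar Phi g' * dvar Phi g'' -
       dvar Phi h * dvar Phi h' * dvar Phi h'').
  by move/(Srels _ _ _ iP) => H; exact: (SE _ _ _ _ (m3 g g' g'') (m3 h h' h'') H).
case: (nth _ P i) S1 S2 S3 => [c|c|c j|j] S1 S2 S3 cB.
- by split=> //; apply: S2; rewrite inE eqxx.
- by split=> //; [apply: S2; rewrite inE eqxx|apply: S3; rewrite !inE eqxx orbT].
- by split=> //; [apply: S2; rewrite inE eqxx|apply: S3; rewrite !inE eqxx orbT].
- by apply: S1; rewrite inE eqxx.
Qed.

End Encoding.

Local Close Scope ring_scope.

(** * From recursive functions to counter machines *)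

Inductive com : Type :=
| CSkip
| CInc of nat
| CDec of nat
| CSeq of com & com
| CWhile of nat & com.

Inductive exec : com -> (nat -> nat) -> (nat -> nat) -> Prop :=
| exec_skip s : exec CSkip s s
| exec_inc c s : exec (CInc c) s (upd s c (s c).+1)
| exec_dec c s : exec (CDec c) s (upd s c (s c).-1)
| exec_seq p q s s' s'' : exec p s s' -> exec q s' s'' -> exec (CSeq p q) s s''
| exec_while0 c p s : s c = 0 -> exec (CWhile c p) s s
| exec_whileS c p s s' s'' : s c <> 0 ->
    exec p s s' -> exec (CWhile c p) s' s'' -> exec (CWhile c p) s s''.

(** Jumps are absolute, so [a] carries the address of the first instruction. A loop adds a test
    before its body and a jump back after it, whence the exit address [(a + size l).+2]. *)
Fixpoint flat (a : nat) (p : com) : seq instr :=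
  match p with
  | CSkip => [::]
  | CInc c => [:: IInc c]
  | CDec c => [:: IDec c]
  | CSeq p q => let l := flat a p in l ++ flat (a + size l) q
  | CWhile c p => let l := flat a.+1 p in IJz c (a + size l).+2 :: rcons l (IJmp a)
  end.

Definition reach (P : seq instr) (x y : config) : Prop :=
  exists k, iter k (step P) x = y.

Lemma reach_refl P x : reach P x x. Proof. by exists 0. Qed.

Lemma reach_trans P x y w : reach P x y -> reach P y w -> reach P x w.
Proof. by case=> k1 <- [k2 <-]; exists (k2 + k1); rewrite iterD. Qed.

Lemma reach_step P x y : step P x = y -> reach P x y.
Proof. by move=> e; exists 1. Qed.

Lemma reach_halts P x y : reach P x y -> (halts P x <-> halts P y).
Proof.
by case=> k <-; elim: k => //= k; rewrite halts_step.
Qed.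

Lemma exec_reach p s s' : exec p s s' -> forall P pre post,
  P = pre ++ flat (size pre) p ++ post ->
  reach P (size pre, s) (size pre + size (flat (size pre) p), s').
Proof.
elim=> {p s s'} [s|c s|c s|p q s s' s'' _ IHp _ IHq|c p s s0
  |c p s s' s'' s0 _ IHp _ IHw] P pre post def_P /=.
- by rewrite addn0; apply: reach_refl.
- by apply: reach_step; rewrite /step def_P nth_cat ltnn subnn /= addn1.
- by apply: reach_step; rewrite /step def_P nth_cat ltnn subnn /= addn1.
- set l := flat (size pre) p in def_P *.
  apply: reach_trans (IHp P pre (flat (size pre + size l) q ++ post) _) _.
    by rewrite def_P /= -catA.
  have := IHq P (pre ++ l) post; rewrite size_cat size_cat addnA -/l; apply.
  by rewrite def_P /= -!catA.
- apply: reach_step; rewrite /step def_P nth_cat ltnn subnn /= s0 /=.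
  by rewrite size_rcons !addnS.
- set l := flat (size pre).+1 p in def_P *.
  apply: (@reach_trans _ _ ((size pre).+1, s)).
    apply: reach_step; rewrite /step def_P nth_cat ltnn subnn /=.
    by case: eqP s0.
  apply: (@reach_trans _ _ ((size pre + size l).+1, s')).
    have := IHp P (rcons pre (IJz c (size pre + size l).+2)) (IJmp (size pre) :: post).
    rewrite size_rcons addSn -/l; apply.
    by rewrite def_P /= -/l -cats1 -[rcons pre _]cats1 -!catA.
  apply: (@reach_trans _ _ (size pre, s')); last exact: IHw def_P.
  apply: reach_step; rewrite /step def_P nth_cat /= ltnNge leqW ?leq_addr //=.
  rewrite -addnS addKn /= -/l nth_cat size_rcons ltnSn nth_rcons ltnn eqxx.
  by [].
Qed.

(** After [p], a zero in [o] causes a jump past the end; any other value makes the last two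
    instructions cycle forever. *)
Definition test_code (p : com) (o : nat) : seq instr :=
  let l := flat 0 p in l ++ [:: IJz o (size l).+2; IJmp (size l)].

Lemma test_code_halts p o s s' : exec p s s' -> s' o = 0 ->
  halts (test_code p o) (0, s).
Proof.
move=> /exec_reach H so; apply/(reach_halts (H (test_code p o) [::] _ erefl)).
exists 1; rewrite /= /step /test_code nth_cat ltnn subnn /= so /=.
by rewrite size_cat addn2.
Qed.

Lemma test_code_loops p o s s' : exec p s s' -> s' o <> 0 ->
  ~ halts (test_code p o) (0, s).
Proof.
move=> /exec_reach H so; rewrite (reach_halts (H (test_code p o) [::] _ erefl)).
rewrite /= add0n; set a := size (flat 0 p).
have stuck k : let x := iter k (step (test_code p o)) (a, s') in
    x = (a, s') \/ x = (a.+1, s').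
  elim: k => [|k /= [->|->]]; first by left.
    right; rewrite /step /test_code nth_cat ltnn subnn /=.
    by case: eqP so.
  left; rewrite /step /test_code nth_cat ltnNge leqnSn /= -/a.
  by rewrite subSnn.
case=> k; have := stuck k => /= -[] ->; rewrite /= size_cat -/a /=; lia.
Qed.

Lemma exec_eq p s s1 s2 : exec p s s1 -> s1 =1 s2 -> exec p s s2.
Proof. by move=> E /functional_extensionality <-. Qed.

(** Total correctness with a known number [N] of passes: [I j] describes the state after [j] passes,
    and the guard vanishes exactly at [N]. *)
Lemma while_inv c body (I : nat -> (nat -> nat) -> Prop) N s :
  I 0 s ->
  (forall j s, j < N -> I j s -> s c <> 0 /\ exists2 s', exec body s s' & I j.+1 s') ->
  (forall s, I N s -> s c = 0) ->
  exists2 s', exec (CWhile c body) s s' & I N s'.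
Proof.
move=> I0 IS IN.
have H k j s1 : j + k = N -> I j s1 ->
    exists2 s', exec (CWhile c body) s1 s' & I N s'.
  elim: k j s1 => [|k IH] j s1.
    by rewrite addn0 => -> Is1; exists s1 => //; apply: exec_while0; apply: IN.
  move=> jk Ij; have jN : j < N by lia.
  have [s1c [s2 Es2 I2]] := IS j s1 jN Ij.
  have [|s3 E3 I3] := IH j.+1 s2 _ I2; first by lia.
  by exists s3 => //; apply: exec_whileS E3.
exact: (H N 0).
Qed.

(** * Basic register operations *)

Definition cclear (r : nat) : com := CWhile r (CDec r).
Definition cmove (x y : nat) : com := CWhile x (CSeq (CDec x) (CInc y)).
Definition ccopy (x y t : nat) : com :=
  CSeq (CWhile x (CSeq (CDec x) (CSeq (CInc t) (CInc y)))) (cmove t x).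

Ltac upd_ext :=
  let q := fresh "q" in
  move=> q; rewrite /upd /=; repeat case: eqP => ?; subst; rewrite /=;
  try lia; try congruence.

Lemma exec_clear s r : exec (cclear r) s (upd s r 0).
Proof.
have [|j s1 jN -> |s1 ->|s' E def_s'] := @while_inv r (CDec r)
  (fun j s' => s' = upd s r (s r - j)) (s r) s.
- by apply: functional_extensionality; upd_ext.
- split; first by rewrite /upd eqxx; lia.
  by eexists; [apply: exec_dec|apply: functional_extensionality; upd_ext].
- by rewrite /upd eqxx subnn.
by apply: exec_eq E _; rewrite def_s' subnn; upd_ext.
Qed.

Lemma exec_move s x y : x <> y ->
  exec (cmove x y) s (upd (upd s x 0) y (s y + s x)).
Proof.
move=> xy.
have [|j s1 jN -> |s1 -> |s' E def_s'] := @while_inv x (CSeq (CDec x) (CInc y))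
  (fun j s' => s' = upd (upd s x (s x - j)) y (s y + j)) (s x) s.
- by apply: functional_extensionality; upd_ext.
- split; first by rewrite /upd eqxx; case: eqP => //; lia.
  eexists; first by apply: exec_seq; [apply: exec_dec|apply: exec_inc].
  by apply: functional_extensionality; upd_ext.
- by rewrite /upd eqxx; case: eqP => // _; lia.
by apply: exec_eq E _; rewrite def_s' subnn; upd_ext.
Qed.

Lemma exec_copy s x y t : x <> y -> t <> x -> t <> y -> s t = 0 ->
  exec (ccopy x y t) s (upd s y (s y + s x)).
Proof.
move=> xy tx ty t0.
have [|j s1 jN -> |s1 -> |s' E def_s'] :=
  @while_inv x (CSeq (CDec x) (CSeq (CInc t) (CInc y)))
  (fun j s' => s' = upd (upd (upd s x (s x - j)) t j) y (s y + j)) (s x) s.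
- by apply: functional_extensionality; upd_ext.
- split; first by rewrite /upd eqxx; repeat case: eqP => //; lia.
  eexists.
    by apply: exec_seq; [apply: exec_dec|apply: exec_seq; apply: exec_inc].
  by apply: functional_extensionality; upd_ext.
- by rewrite /upd eqxx; repeat case: eqP => //; lia.
apply: exec_seq E _; apply: exec_eq (exec_move _ tx) _.
by rewrite def_s'; upd_ext.
Qed.

(** * Compilation of recursive functions *)

Fixpoint cclears (j n : nat) : com :=
  if n is n'.+1 then CSeq (cclear j) (cclears j.+1 n') else CSkip.

(** Arguments sit in the registers [rs], the result goes to [o], and scratch space starts at [b].
    For [rPrec], [i] is the recursion index, [r] the current value, [t] the next one and [n] the
    number of passes left. The local fixpoint lets the recursion go through the list in [rComp]. *)
Fixpoint compile (p : recf) (rs : seq nat) (o b : nat) {struct p} : com :=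
  match p with
  | rZero => CSkip
  | rSucc =>
      if rs is x :: _ then CSeq (ccopy x o b) (CInc o) else CInc o
  | rProj i => if i < size rs then ccopy (nth 0 rs i) o b else CSkip
  | rComp f gs =>
      let sc := b + size gs in
      let fix compile_args gs j :=
        if gs is g :: gs'
        then CSeq (compile g rs j sc) (compile_args gs' j.+1) else CSkip in
      CSeq (compile_args gs b)
        (CSeq (compile f (iota b (size gs)) o sc) (cclears b (size gs)))
  | rPrec f g =>
      if rs is x :: rs' then
        let i := b in let r := b.+1 in let t := b.+2 in let n := b.+3 in
        let sc := b.+4 in
        CSeq (compile f rs' r sc) (CSeq (ccopy x n sc) (CSeq
          (CWhile n (CSeq (CDec n) (CSeq (compile g [:: i, r & rs'] t sc)
            (CSeq (cclear r) (CSeq (cmove t r) (CInc i))))))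
          (CSeq (cmove r o) (cclear i))))
      else CSkip
  | rMu f =>
      let i := b in let t := b.+1 in let sc := b.+2 in
      let body := compile f (i :: rs) t sc in
      CSeq body (CSeq (CWhile t (CSeq (cclear t) (CSeq (CInc i) body))) (cmove i o))
  end.

Fixpoint compile_args (rs : seq nat) (sc : nat) (gs : seq recf) (j : nat) : com :=
  if gs is g :: gs'
  then CSeq (compile g rs j sc) (compile_args rs sc gs' j.+1) else CSkip.

Lemma compile_rComp f gs rs o b : compile (rComp f gs) rs o b =
  let sc := b + size gs in
  CSeq (compile_args rs sc gs b)
    (CSeq (compile f (iota b (size gs)) o sc) (cclears b (size gs))).
Proof.
rewrite /=; congr (CSeq _ _); move: (b + size gs) => sc.
by elim: gs b => //= g gs IH b; rewrite IH.
Qed.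

Fixpoint all_recf (Q : recf -> Prop) (gs : seq recf) : Prop :=
  if gs is g :: gs' then Q g /\ all_recf Q gs' else True.

(* The automatic scheme has no induction hypothesis for the list in [rComp]. *)
Lemma recf_nested_ind (Q : recf -> Prop) :
  Q rZero -> Q rSucc -> (forall i, Q (rProj i)) ->
  (forall f gs, Q f -> all_recf Q gs -> Q (rComp f gs)) ->
  (forall f g, Q f -> Q g -> Q (rPrec f g)) -> (forall f, Q f -> Q (rMu f)) ->
  forall p, Q p.
Proof.
move=> Q0 QS Qi QC QP QM; fix IH 1 => -[||i|f gs|f g|f].
- exact: Q0.
- exact: QS.
- exact: Qi.
- apply: QC; first exact: IH.
  by elim: gs => [|g gs IHgs] /=; [|split; [exact: IH|exact: IHgs]].
- by apply: QP; exact: IH.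
- by apply: QM; exact: IH.
Qed.

Definition setl (s : nat -> nat) (j : nat) (ws : seq nat) : nat -> nat :=
  fun r => if j <= r < j + size ws then nth 0 ws (r - j) else s r.

Lemma exec_clears s j n :
  exec (cclears j n) s (setl s j (nseq n 0)).
Proof.
elim: n j s => [|n IH] j s /=.
  by apply: exec_eq (exec_skip s) _ => q; rewrite /setl; case: ifP => //=; lia.
apply: exec_seq (exec_clear s j) _; apply: exec_eq (IH _ _) _ => q.
change (0 :: nseq n 0) with (nseq n.+1 0).
rewrite /setl !size_nseq !nth_nseq !if_same /upd.
by repeat case: ifP => //; lia.
Qed.

Lemma revals_size gs v ws : revals gs v ws -> size ws = size gs.
Proof.
elim: gs ws => [|g gs IH] ws H; first by inversion H.
by inversion H as [|g' gs' v' w ws' _ Hws]; subst; rewrite /= (IH _ Hws).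
Qed.

(* Registers from b on are scratch: [compile p rs o b] needs them to be zero and
   resets them. *)
Definition frame (rs : seq nat) (o b : nat) (s : nat -> nat) : Prop :=
  [/\ o < b, all (fun r => r < b) rs, o \notin rs, s o = 0 &
      forall r, b <= r -> s r = 0].

Definition compile_ok (p : recf) : Prop := forall rs o b s y,
  reval p (map s rs) y -> frame rs o b s -> exec (compile p rs o b) s (upd s o y).

Lemma map_agree (s s' : nat -> nat) b rs : all (fun r => r < b) rs ->
  (forall r, r < b -> s' r = s r) -> map s' rs = map s rs.
Proof. by move=> /allP rb ss'; apply/eq_in_map => r /rb; apply: ss'. Qed.

(** Inputs lie below [b] and results are written at [b] or above, so each function still sees the
    original inputs after the earlier ones have run. *)
Lemma exec_compile_args rs sc b gs j s ws : all_recf compile_ok gs ->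
  revals gs (map s rs) ws -> all (fun r => r < b) rs -> b <= j ->
  j + size gs <= sc -> (forall r, j <= r -> s r = 0) ->
  exec (compile_args rs sc gs j) s (setl s j ws).
Proof.
move=> + + rsb; elim: gs j s ws => [|g gs IH] j s ws /= ok Hws bj jsc s0.
  inversion Hws; subst; apply: exec_eq (exec_skip s) _ => q.
  by rewrite /setl; case: ifP => //=; lia.
case: ok => okg okgs; inversion Hws as [|g' gs' v w ws' Hg Hgs]; subst.
apply: (@exec_seq _ _ _ (upd s j w)).
  apply: okg => //; split => //; try lia.
  - by apply: sub_all rsb => r; lia.
  - by apply/negP => /(allP rsb); lia.
  - exact: s0.
  - by move=> r rsc; apply: s0; lia.
apply: exec_eq (IH j.+1 _ ws' okgs _ _ _ _) _; try lia.
- rewrite (@map_agree s _ b) // => r rb; rewrite /upd; case: eqP => //; lia.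
- by move=> r jr; rewrite /upd; case: eqP => [|_]; [lia|apply: s0; lia].
move=> q; rewrite /setl /upd /=.
case: (eqVneq q j) => [->|qj]; first by rewrite ltnn leqnn addnS ltnS leq_addr subnn.
have -> : (j <= q < j + (size ws').+1) = (j < q < j.+1 + size ws') by lia.
by case: ifP => // jq; have -> : q - j = (q - j.+1).+1 by lia.
Qed.

(** Collects the intermediate values of the recursion into one function [R], which then states the
    loop invariant. *)
Lemma prec_chain f g N v y : reval (rPrec f g) (N :: v) y ->
  exists R : nat -> nat, [/\ reval f v (R 0), R N = y &
    forall j, j < N -> reval g [:: j, R j & v] (R j.+1)].
Proof.
elim: N y => [|N IH] y H.
  by exists (fun=> y); split=> //; inversion H.
inversion H as [| | | | |f' g' k v' r y' Hr Hg|]; subst.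
have [R [R0 RN RS]] := IH _ Hr.
exists (fun j => if j <= N then R j else y); split => //; first by rewrite ltnn.
move=> j jN /=; case: (eqVneq j N) => [->|nj]; first by rewrite leqnn ltnn RN.
have lt_jN : j < N by lia.
by rewrite (ltnW lt_jN) lt_jN; apply: RS.
Qed.

Lemma compile_correct p : compile_ok p.
Proof.
elim/recf_nested_ind: p => [||i|f gs IHf IHgs|f g IHf IHg|f IHf] rs o b s y Hy
  [ob rsb ors so sb].
- inversion Hy; subst; apply: exec_eq (exec_skip s) _; upd_ext.
- inversion Hy; subst; case: rs rsb ors {Hy} => [|x rs] /= rsb ors.
    by apply: exec_eq (exec_inc o s) _; upd_ext.
  move: rsb ors; rewrite inE negb_or => /andP[xb _] /andP[/eqP ox _].
  apply: exec_seq (@exec_copy s x o b _ _ _ _) _; try lia; first exact: sb.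
  by apply: exec_eq (exec_inc _ _) _; upd_ext.
- inversion Hy; subst; rewrite /=; case: ifP => ir; last first.
    apply: exec_eq (exec_skip s) _ => q.
    rewrite nth_default; last by rewrite size_map leqNgt ir.
    by rewrite /upd; case: eqP => // ->.
  have xin : nth 0 rs i \in rs by apply: mem_nth.
  have xb := allP rsb _ xin.
  have xo : nth 0 rs i <> o by move=> e; rewrite e in xin; case/negP: ors.
  rewrite (nth_map 0) //; move: (nth 0 rs i) xb xo {Hy xin} => x xb xo.
  apply: exec_eq (@exec_copy s x o b _ _ _ _) _; try lia; first exact: sb.
  by upd_ext.
- inversion Hy as [| | |f' gs' v ws y' Hgs Hf| | |]; subst; rewrite compile_rComp /=.
  have sz := revals_size Hgs.
  apply: exec_seq (exec_compile_args IHgs Hgs rsb _ _ sb) _ => //.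
  have iota_ws : map (setl s b ws) (iota b (size gs)) = ws.
    apply: (@eq_from_nth _ 0); rewrite size_map size_iota ?sz // => k kws.
    rewrite (nth_map 0) ?size_iota // nth_iota // /setl sz leq_addr ltn_add2l kws.
    by rewrite addKn.
  apply: (@exec_seq _ _ _ (upd (setl s b ws) o y)).
    apply: IHf; first by rewrite iota_ws.
    split; first lia.
    - by apply/allP => r; rewrite mem_iota => /andP[].
    - by rewrite mem_iota; lia.
    - by rewrite /setl ifF //; lia.
    - by move=> r br; rewrite /setl ifF; [apply: sb|]; lia.
  apply: exec_eq (exec_clears _ _ _) _ => q; rewrite /setl /upd size_nseq sz.
  rewrite nth_nseq if_same; case: ifP => [/andP[bq _]|-> //].
  by case: eqP => [e|_]; [lia|rewrite sb].
- case: rs Hy rsb ors => [|x rs] /= Hy rsb ors; first by inversion Hy.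
  move: rsb ors; rewrite inE negb_or => /andP[xb rsb] /andP[/eqP ox ors].
  have [R [R0 RN RS]] := prec_chain Hy.
  have rs_lt k : b <= k -> all (fun r => r < k) rs.
    by move=> bk; apply: sub_all rsb => r; lia.
  have rs_notin k : b <= k -> k \notin rs by move=> bk; apply/negP => /(allP rsb); lia.
  have [b0 b1 b2 b3] : [/\ s b = 0, s b.+1 = 0, s b.+2 = 0 & s b.+3 = 0].
    by split; apply: sb; lia.
  apply: (@exec_seq _ _ _ (upd s b.+1 (R 0))).
    apply: IHf R0 _; split.
    * lia.
    * by apply: rs_lt; lia.
    * by apply: rs_notin; lia.
    * exact: b1.
    * by move=> r br; apply: sb; lia.
  apply: (@exec_seq _ _ _ (upd (upd s b.+1 (R 0)) b.+3 (s x))).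
    apply: exec_eq (@exec_copy _ x b.+3 b.+4 _ _ _ _) _; try lia.
      by rewrite /upd; case: eqP => [|_]; [lia|apply: sb; lia].
    upd_ext.
  (* Invariant after [j] passes: [b] holds j, [b.+1] holds R j, and [b.+3] holds the number of
     passes left. *)
  have [|j s1 jN -> |s1 -> |s' E def_s'] := @while_inv b.+3
    (CSeq (CDec b.+3) (CSeq (compile g [:: b, b.+1 & rs] b.+2 b.+4)
            (CSeq (cclear b.+1) (CSeq (cmove b.+2 b.+1) (CInc b)))))
    (fun j s' => s' = upd (upd (upd s b j) b.+1 (R j)) b.+3 (s x - j)) (s x)
    (upd (upd s b.+1 (R 0)) b.+3 (s x)).
  + by apply: functional_extensionality; upd_ext.
  + split; first by rewrite /upd eqxx; lia.
    eexists.
      apply: exec_seq (exec_dec _ _) _.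
      apply: (@exec_seq _ _ _ (upd (upd (upd (upd s b j) b.+1 (R j)) b.+3
        (s x - j.+1)) b.+2 (R j.+1))).
        have -> : upd (upd (upd (upd s b j) b.+1 (R j)) b.+3 (s x - j)) b.+3
            (upd (upd (upd s b j) b.+1 (R j)) b.+3 (s x - j) b.+3).-1
            = upd (upd (upd s b j) b.+1 (R j)) b.+3 (s x - j.+1).
          by apply: functional_extensionality; upd_ext.
        apply: IHg.
          rewrite /= (@map_agree s _ b) // => [|r rb]; last first.
            by rewrite /upd; repeat (case: eqP => [e|_]; first lia).
          have -> : upd (upd (upd s b j) b.+1 (R j)) b.+3 (s x - j.+1) b = j.
            by rewrite /upd; repeat case: eqP => //; lia.
          have -> : upd (upd (upd s b j) b.+1 (R j)) b.+3 (s x - j.+1) b.+1 = R j.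
            by rewrite /upd; repeat case: eqP => //; lia.
          exact: RS.
        split; first by lia.
        * by rewrite /= rs_lt; lia.
        * by rewrite !inE (negPf (rs_notin _ _)); lia.
        * by rewrite /upd; repeat case: eqP => //; lia.
        * move=> r br; rewrite /upd; repeat (case: eqP => [|_]; first lia).
          by apply: sb; lia.
      apply: exec_seq (exec_clear _ _) _; apply: exec_seq (exec_move _ _) _; first lia.
      exact: exec_inc.
    apply: functional_extensionality; upd_ext.
  + by rewrite /upd eqxx subnn.
  apply: exec_seq E _; apply: exec_seq (exec_move _ _) _; first lia.
  apply: exec_eq (exec_clear _ _) _; rewrite def_s'; upd_ext.
- inversion Hy as [| | | | | |f' v k Hk Hlt]; subst; rewrite /=.
  have [b0 b1] : s b = 0 /\ s b.+1 = 0 by split; apply: sb; lia.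
  (* The value at [j] guards the search loop: nonzero before [y] and zero at [y], so exactly [y]
     passes are made. *)
  have zex j : j <= y -> exists z, [/\ reval f (j :: map s rs) z,
      j < y -> z <> 0 & j = y -> z = 0].
    rewrite leq_eqVlt => /orP[/eqP ->|jy]; first by exists 0; split=> //; lia.
    by have [z Hz] := Hlt j jy; exists z.+1; split=> // e; lia.
  have run s' z : reval f (s' b :: map s rs) z -> (forall r, r < b -> s' r = s r) ->
      (forall r, b < r -> s' r = 0) ->
      exec (compile f (b :: rs) b.+1 b.+2) s' (upd s' b.+1 z).
    move=> Hz ss' s'0; apply: IHf; first by rewrite /= (@map_agree s _ b).
    split; first lia.
    + by rewrite /= (sub_all _ rsb) ?andbT // => r; lia.
    + by rewrite inE negb_or; apply/andP; split; [lia|apply/negP => /(allP rsb); lia].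
    + by apply: s'0; lia.
    + by move=> r br; apply: s'0; lia.
  have [z0 [Hz0 z0lt z0eq]] := zex 0 (leq0n y).
  apply: (@exec_seq _ _ _ (upd s b.+1 z0)).
    by apply: run => //; [rewrite b0|move=> r br; apply: sb; lia].
  have [|j s1 jy [z [Hz zlt zeq ->]]|s1 [z [_ _ zeq ->]]|s' E [z [_ _ zeq def_s']]] :=
    @while_inv b.+1
    (CSeq (cclear b.+1) (CSeq (CInc b) (compile f (b :: rs) b.+1 b.+2)))
    (fun j s' => exists z, [/\ reval f (j :: map s rs) z, j < y -> z <> 0,
       j = y -> z = 0 & s' = upd (upd s b j) b.+1 z]) y (upd s b.+1 z0).
  + exists z0; split=> //; apply: functional_extensionality; upd_ext.
  + split; first by rewrite /upd eqxx; apply: zlt.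
    have [z' [Hz' z'lt z'eq]] := zex j.+1 jy.
    exists (upd (upd s b j.+1) b.+1 z'); last by exists z'.
    apply: exec_seq (exec_clear _ _) _; apply: exec_seq (exec_inc _ _) _.
    have -> : upd (upd (upd (upd s b j) b.+1 z) b.+1 0) b
        (upd (upd (upd s b j) b.+1 z) b.+1 0 b).+1 = upd (upd s b j.+1) b.+1 0.
      by apply: functional_extensionality; upd_ext.
    apply: exec_eq (run _ z' _ _ _) _; last by upd_ext.
    * by have -> : upd (upd s b j.+1) b.+1 0 b = j.+1
        by rewrite /upd; repeat case: eqP => //; lia.
    * by move=> r rb; rewrite /upd; repeat (case: eqP => [e|_]; first lia).
    * move=> r rb; rewrite /upd; case: eqP => // _.
      by case: eqP => [|_]; [lia|apply: sb; lia].
  + by rewrite /upd eqxx; apply: zeq.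
  apply: exec_seq E _; apply: exec_eq (exec_move _ _) _; first lia.
  by rewrite def_s' (zeq erefl); upd_ext.
Qed.

(** * Codes of instances and the diagonal argument *)

(** The pairing 2^a (2b + 1) by which [CodeSeq.code] encodes a list cell. It is primitive recursive
    in [a], so recursive functions can assemble codes with it. *)
Definition ccons (a b : nat) : nat := 2 ^ a * b.*2.+1.

Lemma code_cons a l : CodeSeq.code (a :: l) = ccons a (CodeSeq.code l).
Proof. by []. Qed.

Definition rAdd : recf := rPrec (rProj 0) (rComp rSucc [:: rProj 1]).
Definition rDouble (p : recf) : recf := rComp rAdd [:: p; p].
Definition rCons : recf :=
  rPrec (rComp rSucc [:: rDouble (rProj 0)]) (rDouble (rProj 1)).
Definition rCC (p q : recf) : recf := rComp rCons [:: p; q].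
Definition rConst (k : nat) : recf := iter k (fun p => rComp rSucc [:: p]) rZero.
Definition rCode (ps : seq recf) : recf := foldr rCC rZero ps.

Lemma reval_comp1 f g v w y : reval g v w -> reval f [:: w] y ->
  reval (rComp f [:: g]) v y.
Proof. by move=> Hg; apply: re_comp; apply: res_cons Hg _; apply: res_nil. Qed.

Lemma reval_comp2 f g h v w x y : reval g v w -> reval h v x ->
  reval f [:: w; x] y -> reval (rComp f [:: g; h]) v y.
Proof.
move=> Hg Hh; apply: re_comp; apply: res_cons Hg _; apply: res_cons Hh _.
exact: res_nil.
Qed.

Lemma reval_add a b : reval rAdd [:: a; b] (a + b).
Proof.
elim: a => [|a IH]; first by apply: re_prec0; apply: (re_proj 0 [:: b]).
apply: re_precS IH _; apply: reval_comp1 (re_proj 1 _) _.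
exact: (re_succ [:: a + b]).
Qed.

Lemma reval_double p v y : reval p v y -> reval (rDouble p) v y.*2.
Proof. by move=> Hp; rewrite -addnn; exact: (reval_comp2 Hp Hp (reval_add y y)). Qed.

Lemma reval_ccons p q v a b : reval p v a -> reval q v b ->
  reval (rCC p q) v (ccons a b).
Proof.
move=> Hp Hq; apply: reval_comp2 Hp Hq _; rewrite /ccons.
elim: a => [|a IH].
  rewrite mul1n; apply: re_prec0; apply: reval_comp1; last exact: (re_succ [:: b.*2]).
  by apply: reval_double; apply: (re_proj 0 [:: b]).
apply: re_precS IH _; rewrite expnS -mulnA mul2n.
by apply: reval_double; apply: (re_proj 1).
Qed.

Lemma reval_code_cons p ps v a l : reval p v a ->
  reval (rCode ps) v (CodeSeq.code l) ->
  reval (rCode (p :: ps)) v (CodeSeq.code (a :: l)).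
Proof. exact: reval_ccons. Qed.

Lemma reval_code_nil v : reval (rCode [::]) v (CodeSeq.code [::]).
Proof. exact: re_zero. Qed.

Lemma reval_const k v : reval (rConst k) v k.
Proof.
elim: k => [|k IH]; first exact: re_zero.
by apply: reval_comp1 IH _; apply: (re_succ [:: k]).
Qed.

(** The code of the zero exponents of all derivations but the first: the part of the code of
    [vexp m k] that does not depend on [k]. *)
Definition vtail (m : nat) : nat :=
  CodeSeq.code [seq CodeSeq.code [:: choice.pickle l; 0]
    | l <- [seq lift ord0 i | i <- enum 'I_m]].

Lemma pickle_vexp m k : choice.pickle (vexp m k) =
  ccons (CodeSeq.code [:: choice.pickle (ord0 : 'I_m.+1); k]) (vtail m).
Proof.
have -> : choice.pickle (vexp m k) =
    CodeSeq.code (map choice.pickle (tfgraph (vexp m k))) by [].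
rewrite -codom_tffun codomE enum_ordSl !map_cons code_cons.
congr (ccons _ _).
  rewrite [choice.pickle _]/(CodeSeq.code
    [:: choice.pickle (ord0 : 'I_m.+1); vexp m k ord0]).
  by rewrite ffunE eqxx.
rewrite /vtail -!map_comp; congr CodeSeq.code; apply: eq_map => l.
rewrite [LHS]/(CodeSeq.code
  [:: choice.pickle (lift ord0 l); vexp m k (lift ord0 l)]).
by rewrite ffunE.
Qed.

Lemma pickle_gen n m (g : dgen n m) :
  choice.pickle (g, 1) =
  CodeSeq.code [:: CodeSeq.code [:: val g.1; choice.pickle g.2]; 1].
Proof. by []. Qed.

Lemma pickle_instance m B (f : seq (dgen (nvars B) m.+1))
    (fs : seq (dcode (nvars B) m.+1)) :
  choice.pickle (existT _ (nvars B) (mon_code f, fs) : dinstance m.+1)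
  = CodeSeq.code [:: nvars B; CodeSeq.code [::
      CodeSeq.code [:: CodeSeq.code [:: choice.pickle (1%R : int);
         CodeSeq.code [seq choice.pickle g | g <- mono f]]]; choice.pickle fs]].
Proof. by []. Qed.

Lemma pickle_gA m B c k : (3 * c < 3 * B) ->
  choice.pickle (gA m B c k, 1) =
  CodeSeq.code [:: CodeSeq.code [:: 3 * c;
    ccons (CodeSeq.code [:: choice.pickle (ord0 : 'I_m.+1); k]) (vtail m)]; 1].
Proof. by move=> cB; rewrite pickle_gen pickle_vexp /gA /= inordK // /nvars; lia. Qed.

(** * The self-referential instance *)

Definition rGen (m c : nat) (p : recf) : recf :=
  rCode [:: rCode [:: rConst (3 * c);
    rCC (rCode [:: rConst (choice.pickle (ord0 : 'I_m.+1)); p]) (rConst (vtail m))];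
    rConst 1].

(** Each input is used twice: as a piece of the code, and as the derivative order of A that records
    the same number in the start configuration. The function depends on [m] only, so it can be
    compiled into the very machine the instance describes. *)
Definition rInstance (m : nat) : recf :=
  rCode [:: rProj 0; rCode [::
    rCode [:: rCode [:: rConst (choice.pickle (1%R : int));
      rCC (rGen m 0 (rProj 0)) (rCC (rGen m 1 (rProj 1))
        (rCC (rGen m 2 (rProj 2)) (rProj 1)))]]; rProj 2]].

Definition start (x0 x1 x2 : nat) : nat -> nat := nth 0 [:: x0; x1; x2].

Definition gtail m (P : seq instr) B : seq (dgen (nvars B) m.+1) :=
  [seq gA m B c 0 | c <- iota 3 (B - 3)] ++
  gQ m P B 0 0 :: [seq gZ m B c | c <- iota 0 B].

Lemma cgens_start m P B x0 x1 x2 : 3 <= B ->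
  cgens m P B (0, start x0 x1 x2) =
  [:: gA m B 0 x0, gA m B 1 x1, gA m B 2 x2 & gtail m P B].
Proof.
move=> B3; have iotaB : iota 0 B = [:: 0, 1, 2 & iota 3 (B - 3)].
  by rewrite -[in LHS](subnKC B3) iotaD.
rewrite /cgens /gtail {1}iotaB /=.
congr [:: _, _, _ & _ ++ _]; apply/eq_in_map => c; rewrite mem_iota => /andP[c3 _].
by rewrite /start nth_default.
Qed.

(* The three registers of the start configuration hold the number of variables,
   the code of the part of f that does not depend on them, and the code of the
   generators: the machine can rebuild the code of this instance from them. *)
Definition dinst m P B : dinstance m.+1 :=
  let R := CodeSeq.code [seq choice.pickle g | g <- mono (gtail m P B)] in
  let fs := machine_code m P B in
  existT _ (nvars B)
    (mon_code (cgens m P B (0, start (nvars B) R (choice.pickle fs))), fs).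

Lemma reval_instance m P B : 3 <= B ->
  let R := CodeSeq.code [seq choice.pickle g | g <- mono (gtail m P B)] in
  reval (rInstance m) [:: nvars B; R; choice.pickle (machine_code m P B)]
    (choice.pickle (dinst m P B)).
Proof.
move=> B3 R; rewrite pickle_instance cgens_start // !map_cons.
rewrite !pickle_gA ?ltn_pmul2l //; try lia.
have gen c p v k : reval p v k -> reval (rGen m c p) v
   (CodeSeq.code [:: CodeSeq.code [:: 3 * c;
    ccons (CodeSeq.code [:: choice.pickle (ord0 : 'I_m.+1); k]) (vtail m)]; 1]).
  move=> Hp; apply: reval_code_cons; last first.
    by apply: reval_code_cons (reval_const _ _) (reval_code_nil _).
  apply: reval_code_cons (reval_const _ _) _.
  apply: reval_code_cons (reval_code_nil _).
  apply: reval_ccons (reval_const _ _).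
  by apply: reval_code_cons (reval_const _ _) (reval_code_cons Hp (reval_code_nil _)).
apply: reval_code_cons (re_proj 0 _) (reval_code_cons _ (reval_code_nil _)).
apply: reval_code_cons _ (reval_code_cons (re_proj 2 _) (reval_code_nil _)).
apply: reval_code_cons _ (reval_code_nil _).
apply: reval_code_cons (reval_const _ _) (reval_code_cons _ (reval_code_nil _)).
rewrite !code_cons.
by do 3 apply: reval_ccons (gen _ _ _ _ (re_proj _ _)) _; apply: (re_proj 1).
Qed.

Lemma foldr_maxn_ub (l : seq nat) n : all (fun k => k <= foldr maxn n l) (n :: l).
Proof.
elim: l => [|k l IH] /=; first by rewrite leqnn.
move: IH => /= /andP[IHn IHl]; rewrite !leq_max IHn leqnn orbT /=.
by apply: sub_all IHl => j jl; rewrite leq_max jl orbT.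
Qed.

Lemma halting_instance (Phi : comNzRingType) m P :
  exists x0 x1 x2 (u : dinstance m.+1),
    reval (rInstance m) [:: x0; x1; x2] (choice.pickle u) /\
    (dmember Phi u <-> halts P (0, start x0 x1 x2)).
Proof.
(* Large enough to exceed the program size and all registers strictly, and to provide the three
   input counters. *)
pose B := (foldr maxn (size P) (map ireg P)).+3.
have /= /andP[B_size B_reg] := foldr_maxn_ub (map ireg P) (size P).
have {}B_size : size P < B by rewrite /B; lia.
have {}B_reg : all (fun i => ireg i < B) P.
  by move: B_reg; rewrite all_map; apply: sub_all => i /=; rewrite /B; lia.
have B3 : 3 <= B by [].
clearbody B; do 3!eexists; exists (dinst m P B); split; first exact: reval_instance.
rewrite /dmember [tagged _]/= dinterp_mon; split; last exact: halts_in_ideal.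
apply: in_ideal_halts => // c Bc; rewrite [_.2]/= /start nth_default //=.
exact: leq_trans B3 Bc.
Qed.

(* Phi: commutative ring with 1 <> 0 (comNzRingType); Delta has m >= 2 elements. *)
Theorem theorem1 (Phi : comNzRingType) (m : nat) (hm : (2 <= m)%N) :
  ~ rec_decidable (@dmember Phi m).
Proof.
case: m hm => // m _ [p decp].
(* Inputs in registers 0, 1, 2, answer in 3, scratch from 4 on. *)
pose body := compile (rComp p [:: rInstance m]) [:: 0; 1; 2] 3 4.
have [x0 [x1 [x2 [u [Hu fu]]]]] := halting_instance Phi m (test_code body 3).
have run y : reval p [:: choice.pickle u] y ->
    exec body (start x0 x1 x2) (upd (start x0 x1 x2) 3 y).
  move=> Hy; apply: compile_correct; first exact: reval_comp1 Hu Hy.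
  by split => //; case=> [|[|[|[|r]]]] //= _; rewrite /start nth_default.
clearbody body; have [decT decF] := decp u.
(* The machine of [u] runs [p] on [u] itself. If [u] is a member, the answer 1 makes it loop,
   although membership means halting; if not, the answer 0 makes it halt, so [u] is a member. *)
have nu : ~ dmember Phi u.
  move=> Du; have /fu := Du; apply: test_code_loops (run _ (decT Du)) _.
  by rewrite /upd eqxx.
apply: (nu); apply/fu; apply: test_code_halts (run _ (decF nu)) _.
by rewrite /upd eqxx.
Qed.
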